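(* Let $p\in\mathbb{N}_0$, $\mu\in(-\tfrac12,\infty)\setminus\{0\}$, $z\in\mathbb{C}\setminus(-\infty,1]$ and $x\in\mathbb{C}$. Then $$(z-x)^p=\frac{2^{\mu+\frac12}}{\sqrt{\pi}}\,e^{i\pi(p-\mu-\frac12)}\,\Gamma(\mu)\,p!\,(z^2-1)^{\frac{p+\mu}{2}+\frac14}\sum_{n=0}^p\frac{(-1)^n(n+\mu)\,C_n^\mu(x)}{(p-n)!\,\Gamma(n+p+2\mu+1)}\,Q_{n+\mu-\frac12}^{p+\mu+\frac12}(z).$$
   Context: $\mathbb{N}_0=\{0,1,2,\ldots\}$. For $\alpha\in\mathbb{C}$ and $z\in\mathbb{C}\setminus(-\infty,1]$, $(z^2-1)^\alpha:=(z+1)^\alpha(z-1)^\alpha$ (principal powers). $C_n^\mu$ is the Gegenbauer polynomial $C_n^\mu(x)=\frac{(2\mu)_n}{n!}\,{}_2F_1\!\left(-n,n+2\mu;\mu+\tfrac12;\tfrac{1-x}{2}\right)$. The associated Legendre function of the second kind on $\mathbb{C}\setminus(-\infty,1]$ is $$Q_\nu^\kappa(z)=\frac{\sqrt{\pi}\,e^{i\pi\kappa}\,\Gamma(\nu+\kappa+1)(z^2-1)^{\kappa/2}}{2^{\nu+1}\Gamma(\nu+\frac32)z^{\nu+\kappa+1}}\,{}_2F_1\!\left(\tfrac{\nu+\kappa+1}{2},\tfrac{\nu+\kappa+2}{2};\nu+\tfrac32;\tfrac1{z^2}\right)$$ for $|z|>1$, and by analytic continuation elsewhere in $\mathbb{C}\setminus(-\infty,1]$.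 *)

(* Defs.v *)
From Stdlib Require Import Reals Factorial ClassicalEpsilon.
From Coquelicot Require Import Coquelicot.
Open Scope R_scope.
Open Scope C_scope.

Definition Cexp (z : C) : C :=
  ((exp (Re z) * cos (Im z))%R, (exp (Re z) * sin (Im z))%R).

(* Principal argument of [z <> 0], with values in (-PI, PI]. *)
Definition Carg (z : C) : R :=
  if Rle_dec 0 (Im z) then acos (Re z / Cmod z)%R
  else (- acos (Re z / Cmod z))%R.

Definition Cln (z : C) : C := (ln (Cmod z), Carg z).

(* Principal power [z ^ alpha], for [z <> 0]. *)
Definition Cpower (z alpha : C) : C := Cexp (alpha * Cln z).

(* [(z^2 - 1)^alpha], which by convention is not [Cpower (z^2 - 1) alpha]. *)
Definition zsq_m1_power (z alpha : C) : C :=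
  Cpower (z + 1) alpha * Cpower (z - 1) alpha.

(* Meaningful for convergent [u]. *)
Definition CLim_seq (u : nat -> C) : C :=
  (real (Lim_seq (fun n => Re (u n))), real (Lim_seq (fun n => Im (u n)))).

Definition Csum (a : nat -> C) (n : nat) : C := @sum_n C_AbelianMonoid a n.

Definition CSeries (a : nat -> C) : C := CLim_seq (Csum a).

Fixpoint pochhammer (a : C) (n : nat) : C :=
  match n with
  | O => 1
  | S m => pochhammer a m * (a + INR m)
  end.

(* Euler's limit: Gamma(z) = lim n! n^z / (z (z+1) ... (z+n)), for every [z]
   outside {0, -1, -2, ...}. *)
Definition CGamma (z : C) : C :=
  CLim_seq (fun n =>
    INR (fact n) * Cpower (INR n) z / pochhammer z (S n)).

(* The Gauss series: meaningful for [Cmod z < 1], and for every [z] when [a] or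
   [b] is a nonpositive integer, in which case the series terminates. *)
Definition hyp2F1 (a b c z : C) : C :=
  CSeries (fun k =>
    pochhammer a k * pochhammer b k / (pochhammer c k * INR (fact k)) * z ^ k).

Definition Gegenbauer (n : nat) (mu x : C) : C :=
  pochhammer (2 * mu) n / INR (fact n) *
  hyp2F1 (- INR n) (INR n + 2 * mu) (mu + 1 / 2) ((1 - x) / 2).

Definition analytic_at (f : C -> C) (z0 : C) : Prop :=
  exists r : R, (0 < r)%R /\ exists a : nat -> C,
    forall z : C, (Cmod (z - z0) < r)%R ->
      @is_pseries C_AbsRing C_NormedModule a (z - z0) (f z).

Definition is_analytic_continuation
    (U D : C -> Prop) (f g : C -> C) : Prop :=
  (forall z : C, D z -> analytic_at g z) /\
  (forall z : C, U z -> g z = f z).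

(* The analytic continuation of [f] from [U] to [D].  For [D] open and connected
   and [U] a subset of [D] with nonempty interior, its values on [D] are uniquely
   determined as soon as a continuation exists; values outside [D] are
   irrelevant. *)
Definition analytic_continuation (U D : C -> Prop) (f : C -> C) : C -> C :=
  epsilon (inhabits f) (is_analytic_continuation U D f).

Definition cut_plane (z : C) : Prop := ~ (Im z = 0 /\ Re z <= 1)%R.

Definition LegendreQ_outer (nu kappa z : C) : C :=
  sqrt PI * Cexp (Ci * PI * kappa) * CGamma (nu + kappa + 1) *
  zsq_m1_power z (kappa / 2) /
  (Cpower 2 (nu + 1) * CGamma (nu + 3 / 2) * Cpower z (nu + kappa + 1)) *
  hyp2F1 ((nu + kappa + 1) / 2) ((nu + kappa + 2) / 2) (nu + 3 / 2)
         (1 / z ^ 2).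

Definition LegendreQ (nu kappa : C) : C -> C :=
  analytic_continuation
    (fun z => cut_plane z /\ (1 < Cmod z)%R) cut_plane
    (LegendreQ_outer nu kappa).

(* Main.v *)
(* Put k = p + mu + 1/2 and nu = n + mu - 1/2 with n <= p.  Euler's transformation turns the
   hypergeometric series of Q_nu^k(z), |z| > 1, into one with parameters (1 - M)/2 and -M/2,
   M = p - n, which terminates.  Hence (z^2-1)^(k/2) Q_nu^k(z) is a constant times a polynomial
   of degree M in z, first for |z| > 1 and then, by uniqueness of analytic continuation, on the
   whole cut plane.  The Gamma factors and the phases cancel, and what remains is the binomial
   expansion of (z - x)^p in which each power of x is expanded in Gegenbauer polynomials. *)

Require Import Defs.
From Stdlib Require Import Reals Factorial Lra Lia ClassicalEpsilon Classical.
From Coquelicot Require Import Coquelicot.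
Open Scope R_scope.
Open Scope C_scope.

(** * Sums and series of complex numbers *)

(** [LegendreQ] is an [epsilon] choice among analytic continuations, so nothing can be computed from
    it directly: a candidate has to be exhibited, shown to be analytic on the cut plane, and
    compared with the defining formula for [Cmod z > 1]. What keeps this manageable is that only one
    kind of non-polynomial factor survives, a power with a negative real exponent: Euler's
    transformation produces (1 - w)^(-k), where k = p + mu + 1/2 > 0, and the candidate contains
    (z^2 - 1)^(-k/2). A single binomial series with positive coefficients therefore serves twice. It
    gives the analyticity of the candidate, and it gives Euler's transformation as a Cauchy product
    with a terminating series, whose coefficients are evaluated by the Pfaff-Saalschuetz sum. The
    range mu > -1/2 enters through k > 0, through the positive lower parameter n + mu + 1, and
    through the positive Gamma argument n + p + 2 mu + 1; for mu in (-1/2, 0), Gamma(mu) is reached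
    by the functional equation. *)

Notation is_Cseries := (@is_series C_AbsRing C_NormedModule).

Lemma C_ext (u v : C) : Re u = Re v -> Im u = Im v -> u = v.
Proof. destruct u, v; simpl; intros; subst; reflexivity. Qed.

(** [CLim_seq] works on real and imaginary parts, [is_series] on the uniform structure of C. That
    structure is the product one, so its balls split into coordinates and the two notions can be
    exchanged. *)
Lemma filterlim_C (u : nat -> C) (l : C) :
  filterlim u eventually (@locally C_UniformSpace l) <->
  is_lim_seq (fun n => Re (u n)) (Re l) /\ is_lim_seq (fun n => Im (u n)) (Im l).
Proof.
  split.
  - intros H; rewrite filterlim_locally in H.
    split; apply filterlim_locally; intros eps;
      (eapply filter_imp; [| exact (H eps)]); intros n Hn; apply Hn.
  - intros [H1 H2].
    pose proof (proj1 (filterlim_locally _ _) H1) as K1.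
    pose proof (proj1 (filterlim_locally _ _) H2) as K2.
    apply filterlim_locally; intros eps.
    generalize (filter_and _ _ (K1 eps) (K2 eps)).
    apply filter_imp; intros n [A B]; split; [exact A | exact B].
Qed.

Lemma Re_Csum (a : nat -> C) n : Re (Csum a n) = sum_n (fun k => Re (a k)) n.
Proof.
  unfold Csum; induction n.
  - rewrite !sum_O; reflexivity.
  - rewrite !sum_Sn, <- IHn; reflexivity.
Qed.

Lemma Im_Csum (a : nat -> C) n : Im (Csum a n) = sum_n (fun k => Im (a k)) n.
Proof.
  unfold Csum; induction n.
  - rewrite !sum_O; reflexivity.
  - rewrite !sum_Sn, <- IHn; reflexivity.
Qed.

Lemma Csum_O (a : nat -> C) : Csum a 0 = a 0%nat.
Proof. apply sum_O. Qed.

Lemma Csum_S (a : nat -> C) n : Csum a (S n) = Csum a n + a (S n).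
Proof. apply (@sum_Sn C_AbelianMonoid). Qed.

Lemma Csum_ext (a b : nat -> C) n :
  (forall k, (k <= n)%nat -> a k = b k) -> Csum a n = Csum b n.
Proof. apply sum_n_ext_loc. Qed.

Lemma Csum_plus (a b : nat -> C) n :
  Csum (fun k => a k + b k) n = Csum a n + Csum b n.
Proof. apply (@sum_n_plus C_AbelianMonoid). Qed.

Lemma Csum_scal (c : C) (a : nat -> C) n :
  Csum (fun k => c * a k) n = c * Csum a n.
Proof. apply (@sum_n_mult_l C_Ring). Qed.

Lemma Csum_RtoC (a : nat -> R) n :
  Csum (fun k => RtoC (a k)) n = RtoC (sum_n a n).
Proof.
  apply C_ext; [rewrite Re_Csum | rewrite Im_Csum]; simpl.
  - apply sum_n_ext; reflexivity.
  - induction n; [rewrite sum_O | rewrite sum_Sn, IHn]; simpl; auto.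
    unfold plus; simpl; ring.
Qed.

Lemma Csum_shift (a : nat -> C) n :
  Csum a (S n) = a 0%nat + Csum (fun k => a (S k)) n.
Proof.
  induction n.
  - rewrite Csum_S, !Csum_O; ring.
  - rewrite Csum_S, IHn, (Csum_S (fun k => a (S k))); ring.
Qed.

Lemma Csum_extend (a : nat -> C) n m :
  (forall k, (n < k)%nat -> a k = 0) -> (n <= m)%nat -> Csum a m = Csum a n.
Proof.
  intros Ha H; induction H; auto.
  rewrite Csum_S, IHle, Ha by lia; ring.
Qed.

Lemma is_Cseries_iff (a : nat -> C) (l : C) :
  is_Cseries a l <->
  is_series (fun n => Re (a n)) (Re l) /\ is_series (fun n => Im (a n)) (Im l).
Proof.
  unfold is_series.
  rewrite (filterlim_C (sum_n a) l).
  split; intros [H1 H2]; split;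
    (eapply filterlim_ext; [| first [exact H1 | exact H2]]); intros n; simpl;
    try exact (Re_Csum a n); try exact (Im_Csum a n);
    symmetry; try exact (Re_Csum a n); exact (Im_Csum a n).
Qed.

Lemma CLim_seq_unique (u : nat -> C) (l : C) :
  is_lim_seq (fun n => Re (u n)) (Re l) -> is_lim_seq (fun n => Im (u n)) (Im l) ->
  CLim_seq u = l.
Proof.
  intros H1 H2; unfold CLim_seq.
  rewrite (is_lim_seq_unique _ _ H1), (is_lim_seq_unique _ _ H2).
  destruct l; reflexivity.
Qed.

Lemma CSeries_unique (a : nat -> C) (l : C) : is_Cseries a l -> CSeries a = l.
Proof.
  intros H; apply filterlim_C in H; destruct H.
  apply CLim_seq_unique; assumption.
Qed.

Lemma is_Cseries_finite (a : nat -> C) N l :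
  (forall k, (N < k)%nat -> a k = 0) -> Csum a N = l -> is_Cseries a l.
Proof.
  intros Ha <-.
  apply filterlim_ext_loc with (fun _ => Csum a N); [| apply filterlim_const].
  exists N; intros n Hn; symmetry; apply Csum_extend; auto.
Qed.

Lemma ex_series_Cmod_Re (a : nat -> C) :
  ex_series (fun n => Cmod (a n)) -> ex_series (fun n => Rabs (Re (a n))).
Proof.
  apply (@ex_series_le R_AbsRing R_CompleteNormedModule); intros n.
  unfold norm; simpl; unfold abs; simpl.
  rewrite Rabs_Rabsolu; apply re_le_Cmod.
Qed.

Lemma Im_le_Cmod (c : C) : (Rabs (Im c) <= Cmod c)%R.
Proof. eapply Rle_trans; [apply Rmax_r | apply Rmax_Cmod]. Qed.

Lemma ex_series_Cmod_Im (a : nat -> C) :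
  ex_series (fun n => Cmod (a n)) -> ex_series (fun n => Rabs (Im (a n))).
Proof.
  apply (@ex_series_le R_AbsRing R_CompleteNormedModule); intros n.
  unfold norm; simpl; unfold abs; simpl.
  rewrite Rabs_Rabsolu; apply Im_le_Cmod.
Qed.

Definition conv (a b : nat -> C) (n : nat) : C :=
  Csum (fun k => a k * b (n - k)%nat) n.

Lemma Cmod_Csum (a : nat -> C) n : (Cmod (Csum a n) <= sum_n (fun k => Cmod (a k)) n)%R.
Proof.
  induction n.
  - rewrite Csum_O, sum_O; lra.
  - rewrite Csum_S, sum_Sn; eapply Rle_trans; [apply Cmod_triangle|].
    unfold plus; simpl; lra.
Qed.

Lemma ex_series_conv (a b : nat -> C) :
  ex_series (fun n => Cmod (a n)) -> ex_series (fun n => Cmod (b n)) ->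
  ex_series (fun n => Cmod (conv a b n)).
Proof.
  intros Ha Hb.
  assert (Habs : forall c : nat -> C, ex_series (fun n => Cmod (c n)) ->
     ex_series (fun n => Rabs (Cmod (c n)))).
  { intros c; apply ex_series_ext; intros n; rewrite Rabs_pos_eq; auto; apply Cmod_ge_0. }
  destruct (Habs _ Ha) as [x Hx], (Habs _ Hb) as [y Hy].
  destruct Ha as [la Hla], Hb as [lb Hlb].
  apply (@ex_series_le R_AbsRing R_CompleteNormedModule) with
    (fun n => sum_f_R0 (fun k => Cmod (a k) * Cmod (b (n - k)%nat))%R n).
  - intros n; unfold norm; simpl; unfold abs; simpl.
    rewrite Rabs_pos_eq by apply Cmod_ge_0.
    eapply Rle_trans; [apply Cmod_Csum|].
    rewrite sum_n_Reals; right; apply sum_eq; intros; apply Cmod_mult.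
  - exists (la * lb)%R; apply (is_series_mult (fun n => Cmod (a n)) (fun n => Cmod (b n)));
      [exact Hla | exact Hlb | exists x; exact Hx | exists y; exact Hy].
Qed.

(** The real and imaginary parts of a Cauchy product are a difference and a sum of two real Cauchy
    products; absolute convergence passes to the four real series, so the real product theorem
    applies to each. *)
Lemma is_Cseries_conv (a b : nat -> C) (la lb : C) :
  is_Cseries a la -> is_Cseries b lb ->
  ex_series (fun n => Cmod (a n)) -> ex_series (fun n => Cmod (b n)) ->
  is_Cseries (conv a b) (la * lb).
Proof.
  rewrite !is_Cseries_iff; intros [Ha1 Ha2] [Hb1 Hb2] Ha Hb.
  pose proof (ex_series_Cmod_Re _ Ha) as A1.
  pose proof (ex_series_Cmod_Im _ Ha) as A2.
  pose proof (ex_series_Cmod_Re _ Hb) as B1.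
  pose proof (ex_series_Cmod_Im _ Hb) as B2.
  split.
  - eapply is_series_ext.
    2: exact (is_series_minus _ _ _ _ (is_series_mult _ _ _ _ Ha1 Hb1 A1 B1)
                 (is_series_mult _ _ _ _ Ha2 Hb2 A2 B2)).
    intros n; unfold conv; rewrite Re_Csum, sum_n_Reals.
    etransitivity; [symmetry; apply minus_sum | reflexivity].
  - eapply is_series_ext.
    2: exact (is_series_plus _ _ _ _ (is_series_mult _ _ _ _ Ha1 Hb2 A1 B2)
                 (is_series_mult _ _ _ _ Ha2 Hb1 A2 B1)).
    intros n; unfold conv; rewrite Im_Csum, sum_n_Reals.
    etransitivity; [symmetry; apply plus_sum | reflexivity].
Qed.

(** * Exponential, logarithm and principal powers *)

Lemma Cexp_plus (u v : C) : Cexp (u + v) = Cexp u * Cexp v.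
Proof.
  destruct u as [a b], v as [c d]; unfold Cexp; simpl.
  rewrite exp_plus, cos_plus, sin_plus; apply C_ext; simpl; ring.
Qed.

Lemma Cexp_0 : Cexp 0 = 1.
Proof. unfold Cexp; simpl; rewrite exp_0, cos_0, sin_0; apply C_ext; simpl; ring. Qed.

Lemma Cexp_opp (u : C) : Cexp u * Cexp (- u) = 1.
Proof. rewrite <- Cexp_plus, <- Cexp_0; f_equal; ring. Qed.

Lemma Cpower_plus (z a b : C) : Cpower z (a + b) = Cpower z a * Cpower z b.
Proof. unfold Cpower; rewrite <- Cexp_plus; f_equal; ring. Qed.

Lemma Cpower_opp (z a : C) : Cpower z a * Cpower z (- a) = 1.
Proof. unfold Cpower; rewrite <- (Cexp_opp (a * Cln z)); do 2 f_equal; ring. Qed.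

Lemma Cpower_neq_0 (z a : C) : Cpower z a <> 0.
Proof. intros H; pose proof (Cpower_opp z a) as K; rewrite H, Cmult_0_l in K;
  apply C1_nz; symmetry; exact K. Qed.

Lemma Cmod_pos (z : C) : z <> 0 -> (0 < Cmod z)%R.
Proof. apply Cmod_gt_0. Qed.

Lemma Cmod_sqr (z : C) : (Cmod z * Cmod z = Re z * Re z + Im z * Im z)%R.
Proof. pose proof (Cmod2_alt z); simpl in *; lra. Qed.

Lemma Carg_bounds (z : C) : z <> 0 -> (- PI < Carg z <= PI)%R.
Proof.
  intros Hz; pose proof (Cmod_pos z Hz) as Hm.
  pose proof (acos_bound (Re z / Cmod z)) as Hb; pose proof PI_RGT_0.
  unfold Carg; destruct (Rle_dec 0 (Im z)) as [H0|H0]; [lra|].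
  (* In the lower half plane the angle is minus an [acos], so the strict bound needs [acos < PI]:
     the value [PI] would mean [Re z = - Cmod z], hence [Im z = 0]. *)
  assert (acos (Re z / Cmod z) < PI)%R; [|lra].
  assert (-1 < Re z / Cmod z)%R.
  { apply Rmult_lt_reg_r with (Cmod z); auto.
    replace (Re z / Cmod z * Cmod z)%R with (Re z) by (field; lra).
    pose proof (Cmod_sqr z); assert (0 < Im z * Im z)%R by nra.
    apply Rnot_le_lt; intros K.
    assert (0 <= (- Cmod z - Re z) * (Cmod z - Re z))%R by (apply Rmult_le_pos; lra).
    nra. }
  assert (Re z / Cmod z <= 1)%R.
  { apply Rmult_le_reg_r with (Cmod z); auto.
    replace (Re z / Cmod z * Cmod z)%R with (Re z) by (field; lra).
    pose proof (re_le_Cmod z); pose proof (Rle_abs (Re z)); lra. }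
  destruct (Rle_lt_or_eq_dec _ _ (proj2 Hb)) as [|E]; auto.
  exfalso; apply (f_equal cos) in E; rewrite cos_acos, cos_PI in E; lra.
Qed.

Lemma polar (z : C) : z <> 0 ->
  Re z = (Cmod z * cos (Carg z))%R /\ Im z = (Cmod z * sin (Carg z))%R.
Proof.
  intros Hz; pose proof (Cmod_pos z Hz) as Hm; pose proof (Cmod_sqr z) as Hs.
  set (q := (Re z / Cmod z)%R).
  assert (Hq : (q * Cmod z = Re z)%R) by (unfold q; field; lra).
  assert (Hq1 : (-1 <= q <= 1)%R).
  { apply Rabs_le_between, Rmult_le_reg_r with (Cmod z); auto.
    rewrite <- (Rabs_pos_eq (Cmod z)) at 1 by lra.
    rewrite <- Rabs_mult, Hq, Rmult_1_l; apply re_le_Cmod. }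
  assert (Hr : (Cmod z * sqrt (1 - q²) = Rabs (Im z))%R).
  { rewrite <- (sqrt_Rsqr (Cmod z)) at 1 by lra.
    rewrite <- sqrt_mult by (unfold Rsqr; nra).
    rewrite <- sqrt_Rsqr_abs; f_equal; unfold Rsqr; nra. }
  unfold Carg; fold q; destruct (Rle_dec 0 (Im z)) as [H0|H0].
  - rewrite cos_acos, sin_acos, Hr, Rabs_pos_eq by lra; split; lra.
  - rewrite cos_neg, sin_neg, cos_acos, sin_acos by lra.
    rewrite <- Ropp_mult_distr_r, Hr, Rabs_left by lra; split; lra.
Qed.

Lemma polar_unique (r t : R) :
  (0 < r)%R -> (- PI < t <= PI)%R ->
  Cln ((r * cos t)%R, (r * sin t)%R) = (ln r, t).
Proof.
  intros Hr Ht.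
  assert (Hm : Cmod ((r * cos t)%R, (r * sin t)%R) = r).
  { assert (Cmod ((r * cos t)%R, (r * sin t)%R) * Cmod ((r * cos t)%R, (r * sin t)%R) = r * r)%R.
    { rewrite Cmod_sqr; simpl. pose proof (sin2_cos2 t); unfold Rsqr in *; nra. }
    pose proof (Cmod_ge_0 ((r * cos t)%R, (r * sin t)%R)); nra. }
  unfold Cln, Carg; rewrite Hm; simpl; f_equal.
  replace (r * cos t / r)%R with (cos t) by (field; lra).
  destruct (Rle_dec 0 (r * sin t)) as [H|H].
  - apply acos_cos; split; [|lra].
    destruct (Rle_lt_dec 0 t); auto; exfalso.
    assert (0 < sin (- t))%R by (apply sin_gt_0; lra).
    rewrite sin_neg in *; nra.
  - assert (t < 0)%R.
    { destruct (Rlt_le_dec t 0); auto; exfalso; apply H.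
      apply Rmult_le_pos; [lra | apply sin_ge_0; lra]. }
    rewrite <- cos_neg, acos_cos by lra; ring.
Qed.

Lemma Cln_mult (u v : C) :
  u <> 0 -> v <> 0 -> (- PI < Carg u + Carg v <= PI)%R ->
  Cln (u * v) = Cln u + Cln v.
Proof.
  intros Hu Hv H.
  destruct (polar u Hu) as [Ru Iu], (polar v Hv) as [Rv Iv].
  pose proof (Cmod_pos u Hu); pose proof (Cmod_pos v Hv).
  replace (u * v) with
    ((Cmod u * Cmod v * cos (Carg u + Carg v))%R,
     (Cmod u * Cmod v * sin (Carg u + Carg v))%R).
  - rewrite polar_unique by (auto; nra).
    rewrite ln_mult by auto; reflexivity.
  - apply C_ext; simpl; fold (Re u) (Im u) (Re v) (Im v);
    rewrite ?cos_plus, ?sin_plus; rewrite Ru at 1; rewrite Iu at 1;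
    rewrite Rv at 1; rewrite Iv at 1; ring.
Qed.

Lemma Cln_RtoC (x : R) : (0 < x)%R -> Cln x = RtoC (ln x).
Proof.
  intros H; pose proof PI_RGT_0.
  replace (RtoC x) with ((x * cos 0)%R, (x * sin 0)%R).
  - apply polar_unique; lra.
  - rewrite cos_0, sin_0; apply C_ext; simpl; ring.
Qed.

Lemma Cexp_RtoC (x : R) : Cexp x = RtoC (exp x).
Proof. unfold Cexp; simpl; rewrite cos_0, sin_0; apply C_ext; simpl; ring. Qed.

Lemma Cpower_RtoC (x a : R) : (0 < x)%R -> Cpower x a = RtoC (Rpower x a).
Proof.
  intros H; unfold Cpower; rewrite Cln_RtoC, <- RtoC_mult, Cexp_RtoC; auto.
Qed.

Lemma Carg_right (v : C) : (0 < Re v)%R -> Carg v = atan (Im v / Re v).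
Proof.
  intros H.
  assert (Hv : v <> 0) by (intros ->; simpl in H; lra).
  destruct (polar v Hv) as [Rv Iv]; pose proof (Cmod_pos v Hv).
  assert (Hc : (0 < cos (Carg v))%R) by nra.
  replace (Im v / Re v)%R with (tan (Carg v)).
  - rewrite atan_tan; auto.
    pose proof (Carg_bounds v Hv).
    split; apply Rnot_le_lt; intros K.
    + assert (cos (Carg v) <= 0)%R; [|lra].
      rewrite <- cos_neg; apply cos_le_0; lra.
    + assert (cos (Carg v) <= 0)%R; [|lra].
      apply cos_le_0; lra.
  - unfold tan; rewrite Iv, Rv; field; lra.
Qed.

Lemma Carg_right_bounds (v : C) : (0 < Re v)%R -> (- PI / 2 < Carg v < PI / 2)%R.
Proof. intros H; rewrite Carg_right by auto; pose proof (atan_bound (Im v / Re v)); lra. Qed.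

Definition slit_plane (u : C) : Prop := ~ (Im u = 0 /\ Re u <= 0)%R.

Lemma slit_neq_0 (u : C) : slit_plane u -> u <> 0.
Proof. intros H ->; apply H; simpl; lra. Qed.

(** A factor [v] in the right half plane turns [u] by less than PI / 2, so a sum of arguments
    leaving the principal range would have a sine of the wrong sign; the two sign hypotheses exclude
    this. On the positive axis [Carg u = 0] and nothing can be crossed. *)
Lemma Cln_mult_right (u v : C) :
  slit_plane u -> (0 < Re v)%R ->
  ((0 < Im u)%R -> (0 < Im (u * v))%R) ->
  ((Im u < 0)%R -> (Im (u * v) < 0)%R) ->
  Cln (u * v) = Cln u + Cln v.
Proof.
  intros Hs Hv H1 H2.
  pose proof (slit_neq_0 u Hs) as Hu.
  assert (Hv0 : v <> 0) by (intros ->; simpl in Hv; lra).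
  apply Cln_mult; auto.
  pose proof (Carg_right_bounds v Hv); pose proof (Carg_bounds u Hu) as Hb.
  destruct (polar u Hu) as [Ru Iu], (polar v Hv0) as [Rv Iv].
  pose proof (Cmod_pos u Hu); pose proof (Cmod_pos v Hv0).
  assert (E : Im (u * v) = (Cmod u * Cmod v * sin (Carg u + Carg v))%R).
  { rewrite sin_plus; simpl; fold (Re u) (Im u) (Re v) (Im v).
    rewrite Ru at 1; rewrite Iu at 1; rewrite Rv at 1; rewrite Iv at 1; ring. }
  rewrite E in *; pose proof PI_RGT_0.
  assert (0 < Cmod u * Cmod v)%R by (apply Rmult_lt_0_compat; auto).
  destruct (Rtotal_order (Im u) 0) as [K|[K|K]].
  - specialize (H2 K).
    assert (Carg u < 0)%R.
    { apply Rnot_le_lt; intros Q; assert (0 <= sin (Carg u))%R by (apply sin_ge_0; lra); nra. }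
    split; [|lra].
    apply Rnot_le_lt; intros Q.
    assert (0 <= sin (Carg u + Carg v))%R; [|nra].
    replace (Carg u + Carg v)%R with (- (- (Carg u + Carg v) - PI) - PI)%R by ring.
    set (x := (- (Carg u + Carg v) - PI)%R).
    assert (0 <= sin x)%R by (apply sin_ge_0; unfold x; lra).
    rewrite sin_minus, cos_PI, sin_PI, sin_neg; lra.
  - assert (0 < Re u)%R.
    { apply Rnot_le_lt; intros Q; apply Hs; split; auto. }
    rewrite (Carg_right u), K by auto.
    replace (0 / Re u)%R with 0%R by (field; lra). rewrite atan_0; lra.
  - specialize (H1 K).
    assert (0 < Carg u)%R.
    { apply Rnot_le_lt; intros Q; assert (0 <= sin (- Carg u))%R by (apply sin_ge_0; lra).
      rewrite sin_neg in *; nra. }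
    split; [lra|].
    apply Rnot_lt_le; intros Q.
    assert (sin (Carg u + Carg v) <= 0)%R; [|nra].
    replace (Carg u + Carg v)%R with (((Carg u + Carg v) - PI) + PI)%R by ring.
    set (x := ((Carg u + Carg v) - PI)%R).
    assert (0 <= sin x)%R by (apply sin_ge_0; unfold x; lra).
    rewrite sin_plus, cos_PI, sin_PI; lra.
Qed.

(** * The binomial series *)

Fixpoint rpoch (a : R) (n : nat) : R :=
  match n with
  | O => 1
  | S m => (rpoch a m * (a + INR m))%R
  end.

Lemma pochhammer_RtoC (a : R) n : pochhammer a n = RtoC (rpoch a n).
Proof.
  induction n; simpl; auto.
  rewrite IHn, <- RtoC_plus, <- RtoC_mult; auto.
Qed.

Lemma rpoch_pos (a : R) n : (0 < a)%R -> (0 < rpoch a n)%R.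
Proof.
  intros Ha; induction n; simpl; [lra|].
  pose proof (pos_INR n); apply Rmult_lt_0_compat; lra.
Qed.

(** The coefficient of w^m in (1 - w)^(-s). It is positive for [s > 0], so absolute convergence at
    [w] is convergence at [Cmod w]. *)
Definition rising_binom (s : R) (m : nat) : R := (rpoch s m / INR (fact m))%R.

Lemma rising_binom_S (s : R) m : (INR (S m) * rising_binom s (S m) = (s + INR m) * rising_binom s m)%R.
Proof.
  unfold rising_binom; rewrite fact_simpl, mult_INR; simpl rpoch.
  pose proof (INR_fact_neq_0 m); pose proof (not_0_INR (S m) (Nat.neq_succ_0 m)).
  field; auto.
Qed.

Lemma rising_binom_pos (s : R) m : (0 < s)%R -> (0 < rising_binom s m)%R.
Proof.
  intros; apply Rdiv_lt_0_compat; [apply rpoch_pos; auto | apply INR_fact_lt_0].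
Qed.

Lemma CV_radius_rising_binom (s : R) : (0 < s)%R -> CV_radius (rising_binom s) = 1%R.
Proof.
  intros Hs; rewrite (CV_radius_finite_DAlembert _ 1%R).
  - f_equal; field.
  - intros n; pose proof (rising_binom_pos s n Hs); lra.
  - lra.
  - apply is_lim_seq_ext with (fun n => 1 + (s - 1) * / INR (S n))%R.
    + intros n; pose proof (rising_binom_pos s n Hs) as H; pose proof (rising_binom_pos s (S n) Hs).
      pose proof (not_0_INR (S n) (Nat.neq_succ_0 n)) as Hn.
      rewrite Rabs_pos_eq by (apply Rlt_le, Rdiv_lt_0_compat; lra).
      apply Rmult_eq_reg_r with (INR (S n) * rising_binom s n)%R; [|apply Rmult_integral_contrapositive; lra].
      transitivity (INR (S n) * rising_binom s (S n))%R; [|field; lra].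
      rewrite rising_binom_S, S_INR in *; field; auto.
    + replace (Finite 1%R) with (Rbar_plus 1 (Rbar_mult (s - 1) 0))%R.
      * apply is_lim_seq_plus'; [apply is_lim_seq_const|].
        apply (is_lim_seq_scal_l _ _ 0%R).
        apply (is_lim_seq_incr_1 (fun n => / INR n)%R).
        replace (Finite 0) with (Rbar_inv p_infty) by reflexivity.
        apply is_lim_seq_inv; [apply is_lim_seq_INR | discriminate].
      * simpl; f_equal; ring.
Qed.

Lemma ex_series_rising_binom (s x : R) :
  (0 < s)%R -> (0 <= x < 1)%R -> ex_series (fun m => rising_binom s m * x ^ m)%R.
Proof.
  intros Hs Hx.
  apply ex_series_ext with (fun m => Rabs (rising_binom s m * x ^ m)).
  - intros n; apply Rabs_pos_eq, Rmult_le_pos;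
      [apply Rlt_le, rising_binom_pos; auto | apply pow_le; lra].
  - apply CV_disk_inside; rewrite CV_radius_rising_binom by auto; simpl.
    rewrite Rabs_pos_eq; lra.
Qed.

(** Derivatives are taken along a real parameter only: the binomial series is followed on the
    segment from 0 to [w], where the real mean value theorem on each component suffices. *)
Definition is_Cderive (f : R -> C) (t : R) (d : C) : Prop :=
  is_derive (fun x => Re (f x)) t (Re d) /\ is_derive (fun x => Im (f x)) t (Im d).

Lemma is_Cderive_mult (f g : R -> C) t df dg :
  is_Cderive f t df -> is_Cderive g t dg ->
  is_Cderive (fun x => f x * g x) t (df * g t + f t * dg).
Proof.
  intros [F1 F2] [G1 G2]; split; simpl; fold (Re (f t)) (Im (f t)) (Re (g t)) (Im (g t)).
  - pose proof (is_derive_minus _ _ _ _ _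
      (is_derive_mult _ _ _ _ _ F1 G1 Rmult_comm) (is_derive_mult _ _ _ _ _ F2 G2 Rmult_comm)) as H.
    eapply is_derive_ext; [| eapply eq_ind; [exact H|]]; [reflexivity|].
    unfold minus, plus, opp, mult; simpl; unfold Re, Im; ring.
  - pose proof (is_derive_plus _ _ _ _ _
      (is_derive_mult _ _ _ _ _ F1 G2 Rmult_comm) (is_derive_mult _ _ _ _ _ F2 G1 Rmult_comm)) as H.
    eapply is_derive_ext; [| eapply eq_ind; [exact H|]]; [reflexivity|].
    unfold minus, plus, opp, mult; simpl; unfold Re, Im; ring.
Qed.

Lemma is_Cderive_Cexp (f : R -> C) t df :
  is_Cderive f t df -> is_Cderive (fun x => Cexp (f x)) t (Cexp (f t) * df).
Proof.
  intros [F1 F2].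
  assert (K : forall (fr fi : R -> R) x y, is_derive fr t x -> is_derive fi t y ->
    is_derive (fun x => exp (fr x) * cos (fi x))%R t
      (exp (fr t) * cos (fi t) * x - exp (fr t) * sin (fi t) * y)%R /\
    is_derive (fun x => exp (fr x) * sin (fi x))%R t
      (exp (fr t) * cos (fi t) * y + exp (fr t) * sin (fi t) * x)%R).
  { intros fr fi x y Hx Hy.
    assert (E1 : ex_derive fr t) by (eexists; exact Hx).
    assert (E2 : ex_derive fi t) by (eexists; exact Hy).
    apply is_derive_unique in Hx, Hy; rewrite <- Hx, <- Hy.
    split; auto_derive; auto;
    change (Derive (fun x => fr x) t) with (Derive fr t);
    change (Derive (fun x => fi x) t) with (Derive fi t); ring. }
  exact (K _ _ _ _ F1 F2).
Qed.

Lemma is_Cderive_scal (c : C) (f : R -> C) t d :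
  is_Cderive f t d -> is_Cderive (fun x => c * f x) t (c * d).
Proof.
  intros H.
  assert (K : is_Cderive (fun _ => c) t 0) by (split; apply (@is_derive_const R_AbsRing R_NormedModule)).
  pose proof (is_Cderive_mult _ _ _ _ _ K H) as L.
  replace (c * d) with (0 * f t + c * d) by ring; exact L.
Qed.

Lemma Cderive_zero_const (f : R -> C) :
  (forall t, (0 <= t <= 1)%R -> is_Cderive f t 0) -> f 1%R = f 0%R.
Proof.
  intros H.
  assert (K : forall g : R -> R, (forall t, (0 <= t <= 1)%R -> is_derive g t 0%R) -> g 1%R = g 0%R).
  { intros g Hg.
    destruct (MVT_gen g 0 1 (fun _ => 0%R)) as [c [_ Hc]].
    - intros x; rewrite Rmin_left, Rmax_right by lra; intros; apply Hg; lra.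
    - intros x; rewrite Rmin_left, Rmax_right by lra; intros Hx.
      apply continuity_pt_filterlim, (@ex_derive_continuous R_AbsRing R_NormedModule).
      eexists; apply Hg; auto.
    - lra. }
  apply C_ext; [apply (K (fun x => Re (f x))) | apply (K (fun x => Im (f x)))];
    intros t Ht; apply (H t Ht).
Qed.

(** The hypothesis keeps 1 - t w in the right half plane, where the logarithm has smooth components:
    half the logarithm of the squared modulus, and [atan] of Im over Re. *)
Lemma is_Cderive_Cln (w : C) (t : R) :
  (0 < 1 - t * Re w)%R ->
  is_Cderive (fun x => Cln (1 - RtoC x * w)) t (- w / (1 - RtoC t * w)).
Proof.
  intros Ht; set (a := Re w) in *; set (b := Im w).
  assert (Hw : w = (a, b)) by (apply C_ext; reflexivity).
  assert (Hloc : locally t (fun x => 0 < 1 - x * a)%R).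
  { assert (Hc : continuous (fun x => 1 - x * a)%R t).
    { apply (@ex_derive_continuous R_AbsRing R_NormedModule); auto_derive; auto. }
    apply Hc, (open_gt 0%R); exact Ht. }
  set (D := ((1 - t * a) * (1 - t * a) + (t * b) * (t * b))%R).
  assert (HD : (0 < D)%R) by (unfold D; nra).
  replace (- w / (1 - RtoC t * w)) with
    ((- (a - t * (a * a + b * b)) / D)%R, (- b / D)%R).
  2: { assert (N : 1 - RtoC t * w <> 0).
       { intros K; apply (f_equal Re) in K; rewrite Hw in K; simpl in K; lra. }
       assert (G : forall Z : C, Z * (1 - RtoC t * w) = - w -> Z = - w / (1 - RtoC t * w)).
       { intros Z <-; field; auto. }
       apply G; rewrite Hw; apply C_ext; simpl; unfold D in *; field; lra. }
  split; simpl Re; simpl Im.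
  - apply is_derive_ext_loc with
      (fun x => / 2 * ln ((1 - x * a) * (1 - x * a) + (x * b) * (x * b)))%R.
    + revert Hloc; apply filter_imp; intros x Hx.
      assert (0 < Cmod (1 - RtoC x * w))%R.
      { apply Cmod_pos; intros K; apply (f_equal Re) in K; rewrite Hw in K; simpl in K; lra. }
      replace ((1 - x * a) * (1 - x * a) + x * b * (x * b))%R with
        (Cmod (1 - RtoC x * w) * Cmod (1 - RtoC x * w))%R.
      * rewrite ln_mult by auto; simpl; field.
      * rewrite Cmod_sqr, Hw; simpl; ring.
    + auto_derive; fold D; [exact HD | unfold D in *; field; lra].
  - apply is_derive_ext_loc with (fun x => atan (- (x * b) / (1 - x * a)))%R.
    + revert Hloc; apply filter_imp; intros x Hx.
      unfold Cln; simpl Im; rewrite Carg_right.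
      * f_equal; rewrite Hw; simpl; f_equal; ring.
      * rewrite Hw; simpl; lra.
    + auto_derive; [lra|].
      unfold D in *; unfold Rsqr; field; repeat split; try lra.
Qed.

(** The term of index 0 carries the factor 0, so re-indexing loses nothing. In the binomial series
    this writes t w B'(t) in the same powers of t as B(t). *)
Lemma is_Cseries_scal_shift (a : nat -> C) l (k : C) :
  is_Cseries (fun m => INR (S m) * a (S m)) l ->
  is_Cseries (fun m => k * (INR m * a m)) (k * l).
Proof.
  intros H; apply (@is_series_scal C_AbsRing C_NormedModule k).
  apply (@is_series_decr_1 C_AbsRing C_NormedModule).
  match goal with |- is_series _ ?x => replace x with l; [exact H|] end.
  change ((l : C) = l + - (RtoC (INR 0) * a 0%nat)); simpl INR; ring.
Qed.

Lemma Re_mult_pow (c : C) (t : R) n : Re (c * RtoC t ^ n) = (Re c * t ^ n)%R.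
Proof. rewrite <- RtoC_pow; simpl; unfold Re; ring. Qed.

Lemma Im_mult_pow (c : C) (t : R) n : Im (c * RtoC t ^ n) = (Im c * t ^ n)%R.
Proof. rewrite <- RtoC_pow; simpl; unfold Im; ring. Qed.

Lemma is_Cseries_PSeries (a : nat -> C) (t : R) :
  Rbar_lt (Rabs t) (CV_radius (fun n => Re (a n))) ->
  Rbar_lt (Rabs t) (CV_radius (fun n => Im (a n))) ->
  is_Cseries (fun n => a n * RtoC t ^ n)
    (PSeries (fun n => Re (a n)) t, PSeries (fun n => Im (a n)) t).
Proof.
  intros H1 H2; apply is_Cseries_iff; split; simpl Re; simpl Im.
  - eapply is_series_ext; [intros n; symmetry; apply Re_mult_pow|].
    apply is_pseries_R, PSeries_correct, CV_radius_inside; auto.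
  - eapply is_series_ext; [intros n; symmetry; apply Im_mult_pow|].
    apply is_pseries_R, PSeries_correct, CV_radius_inside; auto.
Qed.

Lemma is_Cderive_PSeries (a : nat -> C) (t : R) :
  Rbar_lt (Rabs t) (CV_radius (fun n => Re (a n))) ->
  Rbar_lt (Rabs t) (CV_radius (fun n => Im (a n))) ->
  exists d, is_Cderive (fun x => (PSeries (fun n => Re (a n)) x, PSeries (fun n => Im (a n)) x)) t d
    /\ is_Cseries (fun n => INR (S n) * a (S n) * RtoC t ^ n) d.
Proof.
  intros H1 H2.
  exists (PSeries (PS_derive (fun n => Re (a n))) t, PSeries (PS_derive (fun n => Im (a n))) t).
  split; [split; apply is_derive_PSeries; auto|].
  assert (E : forall c n, Re (RtoC c * a n) = (c * Re (a n))%R /\ Im (RtoC c * a n) = (c * Im (a n))%R).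
  { intros; split; simpl; unfold Re, Im; ring. }
  apply is_Cseries_iff; split; simpl Re; simpl Im.
  - eapply is_series_ext;
      [intros n; symmetry; etransitivity; [apply (Re_mult_pow (INR (S n) * a (S n)) t n)|];
       rewrite (proj1 (E (INR (S n)) (S n))); reflexivity|].
    apply (is_pseries_R (PS_derive (fun n => Re (a n)))), PSeries_correct, CV_radius_inside.
    rewrite CV_radius_derive; auto.
  - eapply is_series_ext;
      [intros n; symmetry; etransitivity; [apply (Im_mult_pow (INR (S n) * a (S n)) t n)|];
       rewrite (proj2 (E (INR (S n)) (S n))); reflexivity|].
    apply (is_pseries_R (PS_derive (fun n => Im (a n)))), PSeries_correct, CV_radius_inside.
    rewrite CV_radius_derive; auto.
Qed.

Lemma is_Cseries_unique (a : nat -> C) l1 l2 :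
  is_Cseries a l1 -> is_Cseries a l2 -> l1 = l2.
Proof. intros H1 H2; rewrite <- (CSeries_unique _ _ H1); apply CSeries_unique; auto. Qed.

Lemma CV_radius_ge (a : nat -> R) (r : R) :
  ex_series (fun n => Rabs (a n * r ^ n)%R) -> Rbar_le r (CV_radius a).
Proof.
  intros H; unfold CV_radius.
  apply (proj1 (Lub_Rbar_correct (CV_disk a))); exact H.
Qed.

Lemma ex_series_Cmod_binomial (s : R) (w : C) :
  (0 < s)%R -> (Cmod w < 1)%R ->
  ex_series (fun m => Cmod (RtoC (rising_binom s m) * w ^ m)).
Proof.
  intros Hs Hw.
  eapply ex_series_ext; [| apply (ex_series_rising_binom s (Cmod w) Hs);
    split; [apply Cmod_ge_0 | exact Hw]].
  intros n; rewrite Cmod_mult, Cmod_R, Cmod_pow, Rabs_pos_eq; auto.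
  apply Rlt_le, rising_binom_pos; auto.
Qed.

(* The function [t |-> (sum_m (s)_m/m! (t w)^m) (1 - t w)^s] is constant on [0,1]. *)
Lemma binomial_series (s : R) (w : C) :
  (0 < s)%R -> (Cmod w < 1)%R ->
  is_Cseries (fun m => RtoC (rising_binom s m) * w ^ m) (Cpower (1 - w) (- RtoC s)).
Proof.
  intros Hs Hw.
  set (b := fun m => RtoC (rising_binom s m) * w ^ m).
  pose proof (Cmod_ge_0 w).
  (* Differentiation must be possible up to t = 1 included, so the radius of convergence in t has to
     exceed 1; 2 / (1 + Cmod w) is above 1 and its product with Cmod w is still below 1. *)
  assert (Hrho : exists rho, (1 < rho /\ Cmod w * rho < 1)%R).
  { exists (2 / (1 + Cmod w))%R; split.
    - apply Rmult_lt_reg_r with (1 + Cmod w)%R; [lra|].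
      replace (2 / (1 + Cmod w) * (1 + Cmod w))%R with 2%R by (field; lra); lra.
    - apply Rmult_lt_reg_r with (1 + Cmod w)%R; [lra|].
      replace (Cmod w * (2 / (1 + Cmod w)) * (1 + Cmod w))%R with (2 * Cmod w)%R by (field; lra); lra. }
  destruct Hrho as [rho [Hr1 Hr2]].
  assert (Hb : forall g : C -> R, (forall c, Rabs (g c) <= Cmod c)%R ->
    Rbar_le rho (CV_radius (fun n => g (b n)))).
  { intros g Hg; apply CV_radius_ge.
    apply (@ex_series_le R_AbsRing R_CompleteNormedModule) with
      (fun m => rising_binom s m * (Cmod w * rho) ^ m)%R.
    - intros n; unfold norm; simpl; unfold abs; simpl.
      rewrite Rabs_Rabsolu, Rabs_mult, (Rabs_pos_eq (rho ^ n)) by (apply pow_le; lra).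
      rewrite Rpow_mult_distr, <- Rmult_assoc.
      apply Rmult_le_compat_r; [apply pow_le; lra|].
      eapply Rle_trans; [apply Hg|]; unfold b.
      rewrite Cmod_mult, Cmod_R, Cmod_pow, Rabs_pos_eq; [lra|].
      apply Rlt_le, rising_binom_pos; auto.
    - apply ex_series_rising_binom; auto; split; [apply Rmult_le_pos; lra | lra]. }
  assert (HR : forall t, (0 <= t <= 1)%R ->
    Rbar_lt (Rabs t) (CV_radius (fun n => Re (b n))) /\
    Rbar_lt (Rabs t) (CV_radius (fun n => Im (b n)))).
  { intros t Ht; rewrite Rabs_pos_eq by lra.
    split; (eapply Rbar_lt_le_trans; [| apply Hb]; [simpl; lra|]).
    - exact re_le_Cmod.
    - exact Im_le_Cmod. }
  set (B := fun x => (PSeries (fun n => Re (b n)) x, PSeries (fun n => Im (b n)) x) : C).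
  set (F := fun t => B t * Cexp (s * Cln (1 - RtoC t * w))).
  assert (HF : F 1%R = F 0%R).
  { apply Cderive_zero_const; intros t Ht.
    destruct (HR t Ht) as [R1 R2].
    destruct (is_Cderive_PSeries b t R1 R2) as [d [Hd Hs1]].
    pose proof (is_Cseries_PSeries b t R1 R2) as Hs0; fold (B t) in Hs0.
    assert (Hpos : (0 < 1 - t * Re w)%R).
    { pose proof (re_le_Cmod w) as K; apply Rabs_le_between in K; nra. }
    assert (N : 1 - RtoC t * w <> 0).
    { intros K; apply (f_equal Re) in K; simpl in K.
      unfold Re in Hpos; lra. }
    (* The recurrence (m + 1) b_(m+1) = (s + m) w b_m, read on the series, is the equation (1 - t w)
       B' = s w B. *)
    assert (ODE : d * (1 - RtoC t * w) = s * w * B t).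
    { assert (G : forall d u k : C, d = k + u * d -> d * (1 - u) = k).
      { intros d' u k E; transitivity (d' - u * d'); [ring | rewrite E at 1; ring]. }
      apply G.
      (* At m = 0 the exponent [m - 1] truncates to 0; the factor [INR m] makes that term vanish. *)
      pose proof (is_Cseries_scal_shift (fun m => b m * RtoC t ^ (m - 1)) d (RtoC t * w)) as Hsh.
      eapply is_Cseries_unique; [exact Hs1|].
      pose proof (@is_series_scal C_AbsRing C_NormedModule (s * w) _ _ Hs0) as K1.
      assert (K2 : is_Cseries (fun m => RtoC t * w * (INR m * (b m * RtoC t ^ (m - 1)))) (RtoC t * w * d)).
      { apply Hsh; eapply is_series_ext; [| exact Hs1].
        intros n; replace (S n - 1)%nat with n by lia; simpl; ring. }
      eapply is_series_ext; [| exact (is_series_plus _ _ _ _ K1 K2)].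
      intros n; unfold plus, scal, mult; simpl; unfold mult; simpl.
      assert (Hrec : RtoC (INR (S n)) * b (S n) = (s + INR n) * w * b n).
      { unfold b; simpl Cpow.
        transitivity (RtoC (INR (S n) * rising_binom s (S n)) * (w * w ^ n)); [rewrite RtoC_mult; ring|].
        rewrite rising_binom_S, RtoC_mult, RtoC_plus; ring. }
      change (match n with O => 1%R | S _ => (INR n + 1)%R end) with (INR (S n)).
      transitivity (RtoC (INR (S n)) * b (S n) * RtoC t ^ n); [| reflexivity].
      rewrite Hrec.
      destruct n; [simpl; ring|].
      replace (S n - 1)%nat with n by lia; rewrite Cpow_S; ring. }
    pose proof (is_Cderive_mult _ _ _ _ _ Hd
      (is_Cderive_Cexp _ _ _ (is_Cderive_scal s _ _ _ (is_Cderive_Cln w t Hpos)))) as HD.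
    fold (B t) in HD.
    replace (RtoC 0) with
     (d * Cexp (s * Cln (1 - RtoC t * w)) + B t * (Cexp (s * Cln (1 - RtoC t * w)) *
        (s * (- w / (1 - RtoC t * w))))); [exact HD|].
    transitivity (Cexp (s * Cln (1 - RtoC t * w)) / (1 - RtoC t * w) *
      (d * (1 - RtoC t * w) - s * w * B t)); [field; auto|].
    rewrite ODE; field; auto. }
  assert (H0 : F 0%R = 1).
  { unfold F, B; rewrite !PSeries_0.
    replace (1 - RtoC 0 * w) with (RtoC 1) by ring.
    rewrite Cln_RtoC, ln_1 by lra.
    replace (RtoC s * RtoC 0) with (RtoC 0) by ring; rewrite Cexp_0.
    unfold b, rising_binom; simpl; apply C_ext; simpl; field. }
  assert (E : B 1%R = Cpower (1 - w) (- RtoC s)).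
  { rewrite H0 in HF; unfold F in HF.
    replace (1 - RtoC 1 * w) with (1 - w) in HF by ring.
    fold (Cpower (1 - w) s) in HF.
    transitivity (B 1%R * Cpower (1 - w) s * Cpower (1 - w) (- RtoC s)).
    - rewrite <- Cmult_assoc, Cpower_opp; ring.
    - rewrite HF; ring. }
  rewrite <- E.
  destruct (HR 1%R ltac:(lra)) as [R1 R2].
  eapply is_series_ext; [| exact (is_Cseries_PSeries b 1 R1 R2)].
  intros n; simpl; rewrite Cpow_1_l; unfold b; ring.
Qed.

(** * Analyticity of the elementary closed form *)

Lemma pow_n_Cpow (z : C) k : pow_n (K := C_Ring) z k = z ^ k.
Proof. induction k; simpl; [reflexivity|]; rewrite IHk; reflexivity. Qed.

Lemma is_Cpseries_iff (a : nat -> C) (h l : C) :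
  @is_pseries C_AbsRing C_NormedModule a h l <-> is_Cseries (fun k => a k * h ^ k) l.
Proof.
  assert (E : forall n, scal (V := C_NormedModule) (pow_n (K := C_AbsRing) h n) (a n) = a n * h ^ n).
  { intros n; exact (eq_trans (f_equal (fun x => x * a n) (pow_n_Cpow h n)) (Cmult_comm _ _)). }
  unfold is_pseries; split; apply is_series_ext; intros n; [| symmetry]; apply E.
Qed.

(* Absolute convergence at the radius [r] itself makes the notion stable under Cauchy
   products, without bounding the terms on a smaller disk. *)
Definition abs_analytic_at (f : C -> C) (z0 : C) : Prop :=
  exists r : R, (0 < r)%R /\ exists a : nat -> C,
    ex_series (fun k => Cmod (a k) * r ^ k)%R /\
    forall z : C, (Cmod (z - z0) < r)%R ->
      is_Cseries (fun k => a k * (z - z0) ^ k) (f z).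

Lemma abs_analytic_analytic f z0 : abs_analytic_at f z0 -> analytic_at f z0.
Proof.
  intros [r [Hr [a [_ Ha]]]]; exists r; split; auto; exists a.
  intros z Hz; apply is_Cpseries_iff; auto.
Qed.

Lemma ex_series_Cmod_le (a : nat -> C) (h : C) (r : R) :
  (Cmod h <= r)%R -> ex_series (fun k => Cmod (a k) * r ^ k)%R ->
  ex_series (fun k => Cmod (a k * h ^ k)).
Proof.
  intros H; apply (@ex_series_le R_AbsRing R_CompleteNormedModule); intros n.
  unfold norm; simpl; unfold abs; simpl.
  rewrite Rabs_pos_eq, Cmod_mult, Cmod_pow by apply Cmod_ge_0.
  apply Rmult_le_compat_l; [apply Cmod_ge_0|].
  apply pow_incr; split; [apply Cmod_ge_0 | auto].
Qed.

Lemma ex_series_Cmod_shrink (a : nat -> C) (r r' : R) :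
  (0 <= r' <= r)%R -> ex_series (fun k => Cmod (a k) * r ^ k)%R ->
  ex_series (fun k => Cmod (a k) * r' ^ k)%R.
Proof.
  intros H K; eapply ex_series_ext; [| apply (ex_series_Cmod_le a r' r)]; auto.
  - intros n; simpl; rewrite Cmod_mult, Cmod_pow, Cmod_R, Rabs_pos_eq; lra.
  - rewrite Cmod_R, Rabs_pos_eq; lra.
Qed.

Lemma ex_series_Cmod_finite (a : nat -> C) (r : R) N :
  (forall k, (N < k)%nat -> a k = 0) -> ex_series (fun k => Cmod (a k) * r ^ k)%R.
Proof.
  intros H.
  assert (K : is_Cseries (fun k => RtoC (Cmod (a k) * r ^ k))
                (Csum (fun k => RtoC (Cmod (a k) * r ^ k)) N)).
  { apply is_Cseries_finite with N; auto.
    intros k Hk; rewrite H, Cmod_0, Rmult_0_l by auto; reflexivity. }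
  apply is_Cseries_iff in K; eexists; exact (proj1 K).
Qed.

Lemma abs_analytic_const (c z0 : C) : abs_analytic_at (fun _ => c) z0.
Proof.
  exists 1%R; split; [lra|].
  exists (fun k => match k with O => c | S _ => 0 end); split.
  - apply ex_series_Cmod_finite with 0%nat; intros [|k]; [lia | reflexivity].
  - intros z _.
    apply is_Cseries_finite with 0%nat; [intros [|k] Hk; [lia | simpl; ring]|].
    rewrite Csum_O; simpl; ring.
Qed.

Lemma abs_analytic_id (z0 : C) : abs_analytic_at (fun z => z) z0.
Proof.
  exists 1%R; split; [lra|].
  exists (fun k => match k with O => z0 | 1%nat => 1 | _ => 0 end); split.
  - apply ex_series_Cmod_finite with 1%nat; intros [|[|k]]; [lia | lia | reflexivity].
  - intros z _.
    apply is_Cseries_finite with 1%nat; [intros [|[|k]] Hk; [lia | lia | simpl; ring]|].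
    rewrite Csum_S, Csum_O; simpl; ring.
Qed.

Lemma abs_analytic_plus f g z0 :
  abs_analytic_at f z0 -> abs_analytic_at g z0 -> abs_analytic_at (fun z => f z + g z) z0.
Proof.
  intros [r1 [Hr1 [a [Ha Fa]]]] [r2 [Hr2 [b [Hb Fb]]]].
  set (r := Rmin r1 r2).
  assert (Hr : (0 < r)%R) by (apply Rmin_pos; auto).
  pose proof (Rmin_l r1 r2) as L1; pose proof (Rmin_r r1 r2) as L2; fold r in L1, L2.
  exists r; split; auto; exists (fun k => a k + b k); split.
  - apply (@ex_series_le R_AbsRing R_CompleteNormedModule) with
      (fun k => Cmod (a k) * r ^ k + Cmod (b k) * r ^ k)%R.
    + intros n; unfold norm; simpl; unfold abs; simpl.
      assert (0 <= r ^ n)%R by (apply pow_le; lra).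
      rewrite Rabs_pos_eq by (apply Rmult_le_pos; [apply Cmod_ge_0 | auto]).
      rewrite <- Rmult_plus_distr_r; apply Rmult_le_compat_r; auto; apply Cmod_triangle.
    + apply (@ex_series_plus R_AbsRing R_NormedModule);
        eapply ex_series_Cmod_shrink; eauto; lra.
  - intros z Hz.
    eapply is_series_ext;
      [| exact (is_series_plus _ _ _ _ (Fa z ltac:(lra)) (Fb z ltac:(lra)))].
    intros n; unfold plus; simpl; ring.
Qed.

Lemma conv_pow (a b : nat -> C) (h : C) n :
  conv (fun k => a k * h ^ k) (fun k => b k * h ^ k) n = conv a b n * h ^ n.
Proof.
  unfold conv; rewrite Cmult_comm, <- Csum_scal; apply Csum_ext; intros k Hk.
  replace (h ^ n) with (h ^ k * h ^ (n - k)); [ring|].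
  rewrite <- Cpow_add_r; f_equal; lia.
Qed.

Lemma abs_analytic_mult f g z0 :
  abs_analytic_at f z0 -> abs_analytic_at g z0 -> abs_analytic_at (fun z => f z * g z) z0.
Proof.
  intros [r1 [Hr1 [a [Ha Fa]]]] [r2 [Hr2 [b [Hb Fb]]]].
  set (r := Rmin r1 r2).
  assert (Hr : (0 < r)%R) by (apply Rmin_pos; auto).
  pose proof (Rmin_l r1 r2) as L1; pose proof (Rmin_r r1 r2) as L2; fold r in L1, L2.
  exists r; split; auto; exists (conv a b); split.
  - assert (Hc : Cmod r = r) by (rewrite Cmod_R, Rabs_pos_eq; lra).
    eapply ex_series_ext;
      [| apply (ex_series_conv (fun k => a k * RtoC r ^ k) (fun k => b k * RtoC r ^ k))].
    + intros n; cbv beta; rewrite conv_pow, Cmod_mult, Cmod_pow, Hc; reflexivity.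
    + apply ex_series_Cmod_le with r1; auto; lra.
    + apply ex_series_Cmod_le with r2; auto; lra.
  - intros z Hz; eapply is_series_ext; [intros n; apply conv_pow|].
    apply is_Cseries_conv.
    + apply Fa; lra.
    + apply Fb; lra.
    + apply ex_series_Cmod_le with r1; auto; lra.
    + apply ex_series_Cmod_le with r2; auto; lra.
Qed.

Lemma abs_analytic_pow n z0 : abs_analytic_at (fun z => z ^ n) z0.
Proof.
  induction n; [apply (abs_analytic_const 1)|].
  apply (abs_analytic_mult (fun z => z) (fun z => z ^ n)); auto using abs_analytic_id.
Qed.

Lemma abs_analytic_Csum (f : nat -> C -> C) z0 n :
  (forall k, abs_analytic_at (f k) z0) -> abs_analytic_at (fun z => Csum (fun k => f k z) n) z0.
Proof.
  intros H.
  assert (E : forall (g h : C -> C), (forall z, g z = h z) -> abs_analytic_at g z0 -> abs_analytic_at h z0).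
  { intros g h E [r [Hr [a [Ha Fa]]]]; exists r; split; auto; exists a; split; auto.
    intros z Hz; rewrite <- E; auto. }
  induction n.
  - apply (E (f 0%nat)); auto; intros; rewrite Csum_O; auto.
  - eapply (E (fun z => Csum (fun k => f k z) n + f (S n) z));
      [intros; rewrite Csum_S; auto|].
    apply abs_analytic_plus; auto.
Qed.

Lemma abs_analytic_shift f (c z0 : C) :
  abs_analytic_at f (z0 + c) -> abs_analytic_at (fun z => f (z + c)) z0.
Proof.
  intros [r [Hr [a [Ha Fa]]]]; exists r; split; auto; exists a; split; auto.
  intros z Hz; specialize (Fa (z + c)).
  replace (z + c - (z0 + c)) with (z - z0) in Fa by ring; auto.
Qed.

(** Provides the sign conditions of [Cln_mult_right] on a whole disk: off the real axis the radius
    is the distance to it, and on the positive axis both conditions are void. The bound by [Cmod u0]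
    keeps (u - u0) / u0 inside the unit disk. *)
Lemma slit_radius (u0 : C) : slit_plane u0 ->
  exists r, (0 < r <= Cmod u0)%R /\
    forall u, (Cmod (u - u0) < r)%R ->
      ((0 < Im u0)%R -> (0 < Im u)%R) /\ ((Im u0 < 0)%R -> (Im u < 0)%R).
Proof.
  intros Hs; destruct (Req_dec (Im u0) 0) as [H0|H0].
  - exists (Cmod u0); split; [split; [apply Cmod_pos, slit_neq_0; auto | lra]|].
    intros; split; lra.
  - exists (Rabs (Im u0)); split; [split; [apply Rabs_pos_lt; auto | apply Im_le_Cmod]|].
    intros u Hu; pose proof (Im_le_Cmod (u - u0)) as K.
    change (Im (u - u0)) with (Im u + - Im u0)%R in K.
    unfold Rabs in *; repeat destruct Rcase_abs; split; intros; lra.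
Qed.

Lemma Re_one_minus_pos (w : C) : (Cmod w < 1)%R -> (0 < Re (1 - w))%R.
Proof.
  intros H; pose proof (re_le_Cmod w) as K; apply Rabs_le_between in K.
  change (Re (1 - w)) with (1 + - Re w)%R; lra.
Qed.

(** With w = - (u - u0) / u0 one has u = u0 (1 - w), hence u^(-s) = u0^(-s) (1 - w)^(-s), and the
    binomial series in w is the expansion at u0. Halving the radius secures absolute convergence at
    the radius itself. *)
Lemma abs_analytic_Cpower (s : R) (u0 : C) :
  (0 < s)%R -> slit_plane u0 -> abs_analytic_at (fun u => Cpower u (- RtoC s)) u0.
Proof.
  intros Hs Hu; pose proof (slit_neq_0 _ Hu) as Hn; pose proof (Cmod_pos _ Hn) as Hm.
  destruct (slit_radius u0 Hu) as [r [Hr Hb]].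
  exists (r / 2)%R; split; [lra|].
  exists (fun k => Cpower u0 (- RtoC s) * (RtoC (rising_binom s k) * (- / u0) ^ k)); split.
  - set (w := - / u0 * RtoC (r / 2)).
    assert (Hw : (Cmod w < 1)%R).
    { unfold w; rewrite Cmod_mult, Cmod_opp, Cmod_inv, Cmod_R, Rabs_pos_eq by (auto; lra).
      apply Rmult_lt_reg_l with (Cmod u0); auto.
      rewrite <- Rmult_assoc, Rinv_r; lra. }
    destruct (ex_series_Cmod_binomial s w Hs Hw) as [l Hl].
    exists (Cmod (Cpower u0 (- RtoC s)) * l)%R.
    eapply is_series_ext;
      [| exact (is_series_scal_l (Cmod (Cpower u0 (- RtoC s))) _ _ Hl)].
    intros n; unfold w, scal; simpl; unfold mult; simpl.
    match goal with |- @eq _ ?x ?y => change (@eq R x y) end.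
    rewrite Cpow_mult_l, !Cmod_mult.
    rewrite !Cmod_pow, (Cmod_R (r / 2)), (Rabs_pos_eq (r / 2)) by lra; ring.
  - intros u Hd.
    set (w := - / u0 * (u - u0)).
    assert (Hw : (Cmod w < 1)%R).
    { unfold w; rewrite Cmod_mult, Cmod_opp, Cmod_inv by auto.
      apply Rmult_lt_reg_l with (Cmod u0); auto.
      rewrite <- Rmult_assoc, Rinv_r; lra. }
    assert (E : u0 * (1 - w) = u) by (unfold w; field; auto).
    replace (Cpower u (- RtoC s)) with (Cpower u0 (- RtoC s) * Cpower (1 - w) (- RtoC s)).
    + eapply is_series_ext;
        [| exact (@is_series_scal C_AbsRing C_NormedModule (Cpower u0 (- RtoC s)) _ _
              (binomial_series s w Hs Hw))].
      intros n; unfold scal; simpl; unfold mult; simpl.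
      match goal with |- @eq _ ?x ?y => change (@eq C x y) end.
      unfold w; rewrite Cpow_mult_l; ring.
    + unfold Cpower; rewrite <- Cexp_plus; f_equal.
      rewrite <- E, Cln_mult_right; auto.
      * ring.
      * apply Re_one_minus_pos; auto.
      * rewrite E; apply (Hb u); lra.
      * rewrite E; apply (Hb u); lra.
Qed.

Lemma cut_plane_slit (z : C) : cut_plane z -> slit_plane z /\ slit_plane (z + 1) /\ slit_plane (z - 1).
Proof.
  intros H; repeat split; intros [H1 H2]; apply H; simpl in *; split; try lra;
  unfold Re, Im in *; lra.
Qed.

Lemma abs_analytic_zsq_m1 (s : R) (z : C) :
  (0 < s)%R -> cut_plane z -> abs_analytic_at (fun z => zsq_m1_power z (- RtoC s)) z.
Proof.
  intros Hs Hz; destruct (cut_plane_slit z Hz) as [_ [H1 H2]].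
  apply (abs_analytic_mult (fun z => Cpower (z + 1) (- RtoC s)) (fun z => Cpower (z - 1) (- RtoC s))).
  - apply (abs_analytic_shift (fun u => Cpower u (- RtoC s))), abs_analytic_Cpower; auto.
  - apply (abs_analytic_shift (fun u => Cpower u (- RtoC s))), abs_analytic_Cpower; auto.
Qed.

(** * Identity theorem and Euler's transformation *)

Lemma is_pseries_CV_radius (e : nat -> R) (t l : R) :
  (0 < t)%R -> is_pseries e t l -> Rbar_le t (CV_radius e).
Proof.
  intros Ht H; apply Rbar_not_lt_le; intros K.
  apply (CV_disk_outside e t); [rewrite Rabs_pos_eq by lra; exact K|].
  apply is_pseries_R in H.
  eapply is_lim_seq_ext; [| apply ex_series_lim_0; eexists; exact H].
  intros n; simpl; ring.
Qed.

(** Only positive [t] are available, because in the identity theorem the functions are known to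
    agree on one side of a boundary point. Continuity of the sum at 0 gives the constant term, and
    division by [t] passes to the shifted series, hence the quantification over [e] inside the
    induction. *)
Lemma PSeries_zero (n : nat) : forall (e : nat -> R) (delta : R), (0 < delta)%R ->
  (forall t, (0 < t < delta)%R -> is_pseries e t 0%R) -> e n = 0%R.
Proof.
  assert (H0 : forall (e : nat -> R) (delta : R), (0 < delta)%R ->
    (forall t, (0 < t < delta)%R -> is_pseries e t 0%R) -> e 0%nat = 0%R).
  { intros e delta Hd He.
    destruct (Req_dec (e 0%nat) 0) as [|N]; auto; exfalso.
    assert (Hc : continuity_pt (PSeries e) 0).
    { apply PSeries_continuity; rewrite Rabs_R0.
      eapply Rbar_lt_le_trans; [| apply (is_pseries_CV_radius e (delta / 2) 0); [lra | apply He; lra]].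
      simpl; lra. }
    destruct (Hc (Rabs (e 0%nat)) (Rabs_pos_lt _ N)) as [alp [Ha Hc']].
    set (t := (Rmin alp delta / 2)%R).
    assert (0 < Rmin alp delta)%R by (apply Rmin_pos; auto).
    pose proof (Rmin_l alp delta); pose proof (Rmin_r alp delta).
    specialize (Hc' t).
    simpl in Hc'; unfold Rdist in Hc'.
    rewrite PSeries_0, (is_pseries_unique e t 0) in Hc' by (apply He; unfold t; lra).
    rewrite Rminus_0_l, Rabs_Ropp, Rminus_0_r in Hc'.
    apply (Rlt_irrefl (Rabs (e 0%nat))), Hc'.
    repeat split; [unfold t; lra|].
    rewrite Rabs_pos_eq; unfold t; lra. }
  induction n; [exact H0|].
  intros e delta Hd He.
  apply (IHn (PS_decr_1 e) delta Hd).
  intros t Ht; specialize (He t Ht) as Het.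
  apply (is_pseries_decr_1 e t (/ t)%R) in Het; [| unfold mult, one; simpl; field; lra].
  rewrite (H0 e delta Hd He) in Het.
  replace 0%R with (scal (/ t)%R (plus 0%R (opp 0%R))); [exact Het|].
  unfold scal, plus, opp; simpl; unfold mult; simpl; ring.
Qed.

Lemma is_Cseries_zero (e : nat -> C) (delta : R) : (0 < delta)%R ->
  (forall t : R, (0 < t < delta)%R -> is_Cseries (fun k => e k * RtoC t ^ k) (RtoC 0)) ->
  forall n, e n = 0.
Proof.
  intros Hd He n; apply C_ext.
  - apply (PSeries_zero n (fun k => Re (e k)) delta Hd).
    intros t Ht; apply is_pseries_R.
    eapply is_series_ext; [| exact (proj1 (proj1 (is_Cseries_iff _ _) (He t Ht)))].
    intros k; apply Re_mult_pow.
  - apply (PSeries_zero n (fun k => Im (e k)) delta Hd).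
    intros t Ht; apply is_pseries_R.
    eapply is_series_ext; [| exact (proj2 (proj1 (is_Cseries_iff _ _) (He t Ht)))].
    intros k; apply Im_mult_pow.
Qed.

(* The ray from [-1] through a point [z0] of the cut plane stays in the cut plane
   beyond [z0] and leaves the unit disk, so the set of parameters where [f] and [g]
   differ on it is bounded; its supremum contradicts uniqueness of power series. *)
Lemma cut_plane_identity (f g : C -> C) :
  (forall z, cut_plane z -> analytic_at f z) ->
  (forall z, cut_plane z -> analytic_at g z) ->
  (forall z, cut_plane z -> (1 < Cmod z)%R -> f z = g z) ->
  forall z, cut_plane z -> f z = g z.
Proof.
  intros Hf Hg HU z0 Hz0.
  destruct (classic (f z0 = g z0)) as [|N]; auto; exfalso.
  set (d := z0 + 1); set (ray := fun s : R => RtoC s * d - 1).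
  assert (Hd0 : d <> 0) by (apply slit_neq_0, cut_plane_slit; auto).
  pose proof (Cmod_pos d Hd0) as Hd.
  assert (Hcut : forall s, (1 <= s)%R -> cut_plane (ray s)).
  { intros s Hs [H1 H2]; apply Hz0.
    assert (E1 : Im (ray s) = (s * Im z0)%R) by (unfold ray, d, Im; simpl; ring).
    assert (E2 : Re (ray s) = (s * (Re z0 + 1) - 1)%R) by (unfold ray, d, Re; simpl; ring).
    rewrite E1 in H1; rewrite E2 in H2.
    assert (Im z0 = 0)%R by (destruct (Rmult_integral _ _ H1); lra).
    split; auto; nra. }
  set (S := fun s => (1 <= s)%R /\ f (ray s) <> g (ray s)).
  assert (HS1 : S 1%R).
  { split; [lra|]; replace (ray 1%R) with z0 by (unfold ray, d; ring); auto. }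
  assert (Hbnd : bound S).
  { exists (2 / Cmod d)%R; intros s [Hs Hne]; apply Rnot_lt_le; intros K.
    apply Hne, HU; auto.
    (* Since Cmod (s d - 1) >= s Cmod d - 1, every s > 2 / Cmod d puts the point of the ray outside
       the unit disk. *)
    assert (2 < s * Cmod d)%R.
    { apply Rmult_lt_compat_r with (r := Cmod d) in K; auto.
      replace (2 / Cmod d * Cmod d)%R with 2%R in K by (field; lra); lra. }
    pose proof (Cmod_triangle (ray s) 1) as T.
    replace (ray s + 1) with (RtoC s * d) in T by (unfold ray; ring).
    rewrite Cmod_mult, Cmod_1, Cmod_R, Rabs_pos_eq in T; lra. }
  destruct (completeness S Hbnd (ex_intro _ _ HS1)) as [sg [Hub Hlub]].
  pose proof (Hub _ HS1) as Hsg.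
  destruct (Hf (ray sg) (Hcut _ Hsg)) as [r1 [Hr1 [a Ha]]].
  destruct (Hg (ray sg) (Hcut _ Hsg)) as [r2 [Hr2 [b Hb]]].
  pose proof (Rmin_l r1 r2) as L1; pose proof (Rmin_r r1 r2) as L2.
  assert (Hr : (0 < Rmin r1 r2)%R) by (apply Rmin_pos; auto).
  set (delta := (Rmin r1 r2 / Cmod d)%R).
  assert (Hdl : (0 < delta)%R) by (apply Rdiv_lt_0_compat; auto).
  assert (Hser : forall t, (Rabs t < delta)%R ->
    is_Cseries (fun k => (a k - b k) * d ^ k * RtoC t ^ k) (f (ray (sg + t)%R) - g (ray (sg + t)%R))).
  { intros t Ht.
    assert (E : ray (sg + t)%R - ray sg = RtoC t * d)
      by (unfold ray; rewrite RtoC_plus; ring).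
    assert (Hm : (Cmod (ray (sg + t)%R - ray sg) < Rmin r1 r2)%R).
    { rewrite E, Cmod_mult, Cmod_R.
      apply Rmult_lt_compat_r with (r := Cmod d) in Ht; auto.
      unfold delta in Ht; replace (Rmin r1 r2 / Cmod d * Cmod d)%R with (Rmin r1 r2) in Ht
        by (field; lra); exact Ht. }
    specialize (Ha _ (Rlt_le_trans _ _ _ Hm L1)); specialize (Hb _ (Rlt_le_trans _ _ _ Hm L2)).
    rewrite is_Cpseries_iff, E in Ha, Hb.
    eapply is_series_ext; [| exact (is_series_minus _ _ _ _ Ha Hb)].
    intros k; unfold minus, plus, opp; simpl.
    match goal with |- @eq _ ?x ?y => change (@eq C x y) end.
    rewrite Cpow_mult_l; ring. }
  (* Beyond the supremum [sg] the functions agree, so the difference of their expansions at [ray sg]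
     vanishes for all small positive t and has zero coefficients. The same expansions then give
     agreement below [sg], down to sg - delta, against the choice of [sg]. *)
  assert (Hz : forall n, (a n - b n) * d ^ n = 0).
  { apply is_Cseries_zero with delta; auto; intros t Ht.
    assert (E : f (ray (sg + t)%R) = g (ray (sg + t)%R)).
    { apply NNPP; intros K.
      assert (sg + t <= sg)%R by (apply Hub; split; [lra | auto]); lra. }
    specialize (Hser t); rewrite E in Hser.
    replace (RtoC 0) with (g (ray (sg + t)%R) - g (ray (sg + t)%R)) by ring.
    apply Hser; rewrite Rabs_pos_eq; lra. }
  assert (sg <= sg - delta / 2)%R; [|lra].
  apply Hlub; intros x Hx; apply Rnot_lt_le; intros K.
  pose proof (Hub x Hx); apply (proj2 Hx).
  specialize (Hser (x - sg)%R); replace (sg + (x - sg))%R with x in Hser by ring.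
  apply Ceq_minus; symmetry.
  eapply is_Cseries_unique; [| apply Hser; apply Rabs_lt_between; lra].
  apply is_Cseries_finite with 0%nat.
  - intros k _; rewrite Hz; ring.
  - rewrite Csum_O, Hz; ring.
Qed.

(** Exhibiting [g] shows that a continuation exists, so [epsilon_spec] applies to the chosen one;
    the identity theorem then forces it to equal [g]. *)
Lemma LegendreQ_unique (nu kappa : C) (g : C -> C) :
  (forall z, cut_plane z -> analytic_at g z) ->
  (forall z, cut_plane z -> (1 < Cmod z)%R -> g z = LegendreQ_outer nu kappa z) ->
  forall z, cut_plane z -> LegendreQ nu kappa z = g z.
Proof.
  intros Hg HU z Hz.
  assert (K : is_analytic_continuation (fun z => cut_plane z /\ (1 < Cmod z)%R) cut_plane
     (LegendreQ_outer nu kappa) (LegendreQ nu kappa)).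
  { unfold LegendreQ, analytic_continuation.
    match goal with |- _ _ _ _ (epsilon ?i ?P) => apply (epsilon_spec i P) end.
    exists g; split; auto; intros y [H1 H2]; auto. }
  destruct K as [K1 K2].
  apply cut_plane_identity; auto.
  intros y H1 H2; rewrite HU, K2; auto.
Qed.

Definition hyp_term (a b c : R) (k : nat) : R :=
  (rpoch a k * rpoch b k / (rpoch c k * INR (fact k)))%R.

Lemma hyp_term_S (a b c : R) k : (0 < c)%R ->
  (hyp_term a b c (S k) * (c + INR k) * INR (S k) = (a + INR k) * (b + INR k) * hyp_term a b c k)%R.
Proof.
  intros Hc; unfold hyp_term; rewrite fact_simpl, mult_INR; simpl rpoch.
  pose proof (INR_fact_neq_0 k); pose proof (not_0_INR (S k) (Nat.neq_succ_0 k)).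
  pose proof (rpoch_pos c k Hc); pose proof (pos_INR k).
  field; repeat split; lra.
Qed.

Lemma sum_n_S (x : nat -> R) n : sum_n x (S n) = (sum_n x n + x (S n))%R.
Proof. apply (@sum_Sn R_AbelianMonoid). Qed.

(* Pfaff-Saalschuetz; the summand of the first-order recurrence in [n] telescopes
   with [g k = k (c + k - 1) u_k v_(n+1-k)]. *)
Lemma saalschuetz (a b c : R) n : (0 < c)%R ->
  sum_n (fun k => hyp_term a b c k * rising_binom (c - a - b) (n - k))%R n = hyp_term (c - a) (c - b) c n.
Proof.
  intros Hc; set (u := hyp_term a b c); set (v := rising_binom (c - a - b)).
  induction n.
  - rewrite sum_O; unfold u, v, hyp_term, rising_binom; simpl; field.
  - assert (T : forall m, (m <= n)%nat ->
      (INR (S n) * (c + INR n) * sum_n (fun k => u k * v (S n - k)%nat) m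
       - (c - a + INR n) * (c - b + INR n) * sum_n (fun k => u k * v (n - k)%nat) m
       = - (INR (S m) * (c + INR m) * u (S m) * v (n - m)%nat))%R).
    { assert (step : forall m, (m <= n)%nat ->
        (INR (S n) * (c + INR n) * (u m * v (S n - m)%nat)
         - (c - a + INR n) * (c - b + INR n) * (u m * v (n - m)%nat)
         = INR m * (c + INR m - 1) * u m * v (S n - m)%nat
           - INR (S m) * (c + INR m) * u (S m) * v (n - m)%nat)%R).
      { intros m Hm.
        pose proof (hyp_term_S a b c m Hc) as Hu; fold u in Hu.
        pose proof (rising_binom_S (c - a - b) (n - m)) as Hv; fold v in Hv.
        replace (S n - m)%nat with (S (n - m)) by lia.
        rewrite S_INR, (minus_INR n m) in Hv by lia.
        replace (INR (S m) * (c + INR m) * u (S m) * v (n - m)%nat)%R with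
          ((u (S m) * (c + INR m) * INR (S m)) * v (n - m)%nat)%R by ring.
        rewrite Hu, S_INR.
        transitivity (u m * (INR m * (c + INR m - 1) * v (S (n - m)) +
           (c + INR n + INR m) * ((INR n - INR m + 1) * v (S (n - m)))
           - (c - a + INR n) * (c - b + INR n) * v (n - m)%nat))%R; [ring|].
        rewrite Hv; ring. }
      induction m; intros Hm.
      - rewrite !sum_O, step by lia; simpl INR; ring.
      - rewrite !sum_n_S.
        specialize (IHm ltac:(lia)); specialize (step (S m) Hm).
        replace (S n - S m)%nat with (n - m)%nat in * by lia.
        rewrite (S_INR (S m)) in *; rewrite (S_INR m) in *; nra. }
    (* At m = n the boundary term of the telescoped sum is, up to sign and the factor (n + 1)(c +
       n), the summand k = n + 1 still missing from the sum for n + 1. *)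
    specialize (T n (le_n n)); rewrite IHn in T.
    pose proof (hyp_term_S (c - a) (c - b) c n Hc) as Hh.
    rewrite Nat.sub_diag in T.
    rewrite sum_n_S, Nat.sub_diag.
    assert (v 0%nat = 1)%R by (unfold v, rising_binom; simpl; field).
    pose proof (pos_INR n); rewrite S_INR in *.
    apply Rmult_eq_reg_l with ((INR n + 1) * (c + INR n))%R; [|apply Rgt_not_eq; apply Rmult_lt_0_compat; lra].
    rewrite H in *; nra.
Qed.

Lemma hyp2F1_RtoC (a b c : R) (w : C) : (0 < c)%R ->
  hyp2F1 a b c w = CSeries (fun k => RtoC (hyp_term a b c k) * w ^ k).
Proof.
  intros Hc; unfold hyp2F1, CSeries, CLim_seq.
  assert (E : forall n, Csum (fun k => pochhammer a k * pochhammer b k /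
      (pochhammer c k * INR (fact k)) * w ^ k) n = Csum (fun k => RtoC (hyp_term a b c k) * w ^ k) n).
  { intros n; apply Csum_ext; intros k _; f_equal.
    rewrite !pochhammer_RtoC, <- !RtoC_mult, <- RtoC_div; auto.
    pose proof (rpoch_pos c k Hc); pose proof (INR_fact_lt_0 k).
    apply Rgt_not_eq, Rmult_lt_0_compat; auto. }
  f_equal; f_equal; apply Lim_seq_ext; intros n; rewrite E; auto.
Qed.

(** Multiplying the terminating series with parameters a, b by the binomial series of (1 - w)^(-(c -
    a - b)) gives, by [saalschuetz], the coefficients with parameters c - a, c - b. Termination and
    c - a - b > 0 supply the absolute convergence of the two factors. *)
Lemma euler_transformation (a b c : R) (w : C) N :
  (0 < c)%R -> (0 < c - a - b)%R -> (Cmod w < 1)%R ->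
  (forall k, (N < k)%nat -> hyp_term a b c k = 0%R) ->
  hyp2F1 (RtoC (c - a)) (RtoC (c - b)) c w =
  Cpower (1 - w) (- RtoC (c - a - b)) * Csum (fun k => RtoC (hyp_term a b c k) * w ^ k) N.
Proof.
  intros Hc Hs Hw HN; rewrite hyp2F1_RtoC by auto.
  apply CSeries_unique.
  assert (HN' : forall k, (N < k)%nat -> RtoC (hyp_term a b c k) * w ^ k = 0).
  { intros k Hk; rewrite HN by auto; ring. }
  rewrite Cmult_comm.
  eapply is_series_ext; [| apply (is_Cseries_conv
    (fun k => RtoC (hyp_term a b c k) * w ^ k)
    (fun m => RtoC (rising_binom (c - a - b) m) * w ^ m))].
  - intros n; cbv beta.
    rewrite (conv_pow (fun k => RtoC (hyp_term a b c k)) (fun m => RtoC (rising_binom (c - a - b) m))).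
    rewrite <- saalschuetz by auto.
    apply (f_equal (fun x => x * w ^ n)); unfold conv; rewrite <- Csum_RtoC.
    apply Csum_ext; intros k _; rewrite RtoC_mult; reflexivity.
  - apply is_Cseries_finite with N; auto.
  - apply binomial_series; auto.
  - pose proof (ex_series_Cmod_finite (fun k => RtoC (hyp_term a b c k) * w ^ k) 1%R N HN') as K.
    eapply ex_series_ext; [| exact K]; intros n; cbv beta; rewrite pow1; apply Rmult_1_r.
  - apply ex_series_Cmod_binomial; auto.
Qed.

(** * The Gamma function on (-1, 0) and (0, +oo) *)

Definition euler_quotient (s : R) (n : nat) : R :=
  (INR (fact n) * Rpower (INR n) s / rpoch s (S n))%R.

Lemma rpoch_neq_0 (s : R) n : (-1 < s)%R -> s <> 0%R -> rpoch s n <> 0%R.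
Proof.
  intros H1 H2; induction n; simpl; [lra|].
  apply Rmult_integral_contrapositive; split; auto.
  destruct n; [simpl; lra|]; rewrite S_INR; pose proof (pos_INR n); lra.
Qed.

Lemma rpoch_shift (s : R) n : rpoch s (S n) = (s * rpoch (s + 1) n)%R.
Proof.
  induction n; [simpl; ring|].
  change (rpoch s (S (S n))) with (rpoch s (S n) * (s + INR (S n)))%R.
  rewrite IHn, S_INR; simpl; ring.
Qed.

(** Gamma(s + 1) = s Gamma(s) before passing to the limit; the correction 1 + (s + 1) / n tends to
    1. Index 0 is skipped because division by n and the power n^s have only default values there. *)
Lemma euler_quotient_shift (s : R) n : (-1 < s)%R -> s <> 0%R ->
  euler_quotient (s + 1) (S n) = (euler_quotient s (S n) * (s / (1 + (s + 1) * / INR (S n))))%R.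
Proof.
  intros H1 H2; unfold euler_quotient.
  rewrite Rpower_plus, Rpower_1 by (apply lt_0_INR; lia).
  pose proof (rpoch_neq_0 s (S (S n)) H1 H2) as N.
  change (rpoch (s + 1) (S (S n))) with (rpoch (s + 1) (S n) * (s + 1 + INR (S n)))%R.
  rewrite (rpoch_shift s (S n)) in *.
  pose proof (lt_0_INR (S n) ltac:(lia)).
  assert (rpoch (s + 1) (S n) <> 0)%R by (intros E; apply N; rewrite E; ring).
  field; repeat split; auto; lra.
Qed.

Lemma ln_le_minus_1 (x : R) : (0 < x)%R -> (ln x <= x - 1)%R.
Proof.
  intros H; pose proof (exp_ineq1_le (ln x)); rewrite exp_ln in *; lra.
Qed.

(** Both bounds are ln t <= t - 1, at t = x / y and at t = y / x. *)
Lemma ln_ratio_bounds (x y : R) : (0 < x)%R -> (0 < y)%R ->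
  ((y - x) / y <= ln y - ln x <= (y - x) / x)%R.
Proof.
  intros Hx Hy; split.
  - pose proof (ln_le_minus_1 (x / y) ltac:(apply Rdiv_lt_0_compat; lra)) as K.
    rewrite ln_div in K by auto.
    replace ((y - x) / y)%R with (- (x / y - 1))%R by (field; lra); lra.
  - pose proof (ln_le_minus_1 (y / x) ltac:(apply Rdiv_lt_0_compat; lra)) as K.
    rewrite ln_div in K by auto.
    replace ((y - x) / x)%R with (y / x - 1)%R by (field; lra); lra.
Qed.

Lemma euler_quotient_pos (s : R) n : (0 < s)%R -> (0 < euler_quotient s n)%R.
Proof.
  intros Hs; unfold euler_quotient; apply Rdiv_lt_0_compat; [|apply rpoch_pos; auto].
  apply Rmult_lt_0_compat; [apply INR_fact_lt_0 | apply exp_pos].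
Qed.

Lemma ln_euler_quotient_S (s : R) n : (0 < s)%R ->
  (ln (euler_quotient s (S (S n))) - ln (euler_quotient s (S n)) =
   s * (ln (INR (S (S n))) - ln (INR (S n))) - (ln (INR (S (S n)) + s) - ln (INR (S (S n)))))%R.
Proof.
  intros Hs.
  assert (E : forall m, ln (euler_quotient s m) = (ln (INR (fact m)) + s * ln (INR m) - ln (rpoch s (S m)))%R).
  { intros m; pose proof (INR_fact_lt_0 m); pose proof (rpoch_pos s (S m) Hs); unfold euler_quotient.
    assert (0 < Rpower (INR m) s)%R by apply exp_pos.
    rewrite ln_div, ln_mult by (auto; apply Rmult_lt_0_compat; auto).
    unfold Rpower; rewrite ln_exp; auto. }
  rewrite !E.
  change (rpoch s (S (S (S n)))) with (rpoch s (S (S n)) * (s + INR (S (S n))))%R.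
  rewrite (fact_simpl (S n)), mult_INR.
  pose proof (pos_INR (S (S n))).
  rewrite !ln_mult by (try apply lt_0_INR; try apply lt_O_fact; try apply rpoch_pos; try lra; lia).
  rewrite (Rplus_comm s); ring.
Qed.

(* From [n = 1] on, [euler_quotient s n] increases while [euler_quotient s n * exp (s (1 + s) / n)] decreases. *)
Lemma euler_quotient_lim_pos (s : R) : (0 < s)%R ->
  exists L, (0 < L)%R /\ is_lim_seq (euler_quotient s) L.
Proof.
  intros Hs.
  assert (Hstep : forall n, (0 <= ln (euler_quotient s (S (S n))) - ln (euler_quotient s (S n)) <=
     s * (1 + s) * (/ INR (S n) - / INR (S (S n))))%R).
  { intros n; rewrite ln_euler_quotient_S, (S_INR (S n)) by auto.
    pose proof (lt_0_INR (S n) ltac:(lia)) as Hn; set (x := INR (S n)) in *.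
    pose proof (ln_ratio_bounds x (x + 1) Hn ltac:(lra)) as [A1 A2].
    pose proof (ln_ratio_bounds (x + 1) (x + 1 + s) ltac:(lra) ltac:(lra)) as [B1 B2].
    replace (x + 1 - x)%R with 1%R in * by ring.
    replace (x + 1 + s - (x + 1))%R with s in * by ring.
    apply Rmult_le_compat_l with (r := s) in A1, A2; try lra.
    split.
    - unfold Rdiv in *; lra.
    (* The logarithm bounds leave s / x - s / (x + 1 + s) = s (1 + s) / (x (x + 1 + s)), which is at
       most s (1 + s) (1 / x - 1 / (x + 1)); the latter telescopes to a uniform bound. *)
    - apply Rle_trans with (s * (1 / x) - s / (x + 1 + s))%R; [lra|].
      apply Rmult_le_reg_r with (x * (x + 1) * (x + 1 + s))%R.
      { repeat apply Rmult_lt_0_compat; lra. }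
      field_simplify; [| lra | lra]; nra. }
  destruct (ex_finite_lim_seq_incr (fun n => ln (euler_quotient s (S n)))
     (ln (euler_quotient s 1) + s * (1 + s))) as [l Hl].
  - intros n; specialize (Hstep n); lra.
  - intros n.
    assert (ln (euler_quotient s (S n)) <= ln (euler_quotient s 1) + s * (1 + s) * (1 - / INR (S n)))%R.
    { induction n; [simpl INR; rewrite Rinv_1; lra|].
      specialize (Hstep n); lra. }
    pose proof (Rinv_0_lt_compat _ (lt_0_INR (S n) ltac:(lia))).
    assert (0 < s * (1 + s))%R by nra. nra.
  - exists (exp l); split; [apply exp_pos|].
    apply is_lim_seq_incr_1.
    apply is_lim_seq_ext with (fun n => exp (ln (euler_quotient s (S n)))).
    + intros n; apply exp_ln, euler_quotient_pos; auto.
    + apply is_lim_seq_continuous; auto.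
      apply derivable_continuous_pt, derivable_pt_exp.
Qed.

Lemma is_lim_seq_shift_factor (s : R) :
  is_lim_seq (fun n => 1 + (s + 1) * / INR (S n))%R 1%R.
Proof.
  replace (Finite 1%R) with (Finite (1 + (s + 1) * 0))%R by (f_equal; ring).
  apply is_lim_seq_plus'; [apply is_lim_seq_const|].
  apply (is_lim_seq_scal_l _ _ 0%R).
  apply (is_lim_seq_incr_1 (fun n => / INR n)%R).
  replace (Finite 0) with (Rbar_inv p_infty) by reflexivity.
  apply is_lim_seq_inv; [apply is_lim_seq_INR | discriminate].
Qed.

(** Since s + 1 > 0, the limit exists there by monotonicity, and the shift formula carries it back
    to s, negative values included. Stating both limits together yields the functional equation at
    once. *)
Lemma euler_quotient_lim (s : R) : (-1 < s)%R -> s <> 0%R ->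
  exists L, L <> 0%R /\ is_lim_seq (euler_quotient s) L /\ is_lim_seq (euler_quotient (s + 1)) (s * L)%R.
Proof.
  intros H1 H2.
  destruct (euler_quotient_lim_pos (s + 1) ltac:(lra)) as [L [HL HlL]].
  exists (L / s)%R; split; [apply Rmult_integral_contrapositive; split; [lra | apply Rinv_neq_0_compat; auto]|].
  split.
  - apply is_lim_seq_incr_1.
    apply is_lim_seq_ext with
      (fun n => euler_quotient (s + 1) (S n) * ((1 + (s + 1) * / INR (S n)) * / s))%R.
    + intros n; rewrite euler_quotient_shift by auto.
      pose proof (lt_0_INR (S n) ltac:(lia)) as Hn.
      assert (0 < (s + 1) * / INR (S n))%R
        by (apply Rmult_lt_0_compat; [lra | apply Rinv_0_lt_compat; auto]).
      field; repeat split; lra.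
    + replace (Finite (L / s)) with (Finite (L * (1 * / s))) by (f_equal; field; auto).
      apply is_lim_seq_mult'; [apply (is_lim_seq_incr_1 (euler_quotient (s + 1))); auto|].
      apply is_lim_seq_mult'; [apply is_lim_seq_shift_factor | apply is_lim_seq_const].
  - replace (s * (L / s))%R with L by (field; auto); auto.
Qed.

Lemma CGamma_is_lim (s L : R) : (-1 < s)%R -> s <> 0%R ->
  is_lim_seq (euler_quotient s) L -> CGamma s = L.
Proof.
  intros H1 H2 HL; unfold CGamma.
  assert (E : forall n, (1 <= n)%nat ->
    RtoC (euler_quotient s n) = INR (fact n) * Cpower (INR n) s / pochhammer s (S n)).
  { intros n Hn.
    rewrite Cpower_RtoC by (apply lt_0_INR; lia).
    rewrite pochhammer_RtoC, <- RtoC_mult, <- RtoC_div by (apply rpoch_neq_0; auto); auto. }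
  apply CLim_seq_unique.
  - eapply is_lim_seq_ext_loc; [| exact HL].
    exists 1%nat; intros n Hn; rewrite <- E by auto; reflexivity.
  - eapply is_lim_seq_ext_loc; [| exact (is_lim_seq_const 0%R)].
    exists 1%nat; intros n Hn; rewrite <- E by auto; reflexivity.
Qed.

Lemma CGamma_neq_0 (s : R) : (-1 < s)%R -> s <> 0%R -> CGamma s <> 0.
Proof.
  intros H1 H2; destruct (euler_quotient_lim s H1 H2) as [L [HL [K _]]].
  rewrite (CGamma_is_lim s L); auto; intros E; apply HL, RtoC_inj; auto.
Qed.

Lemma CGamma_S (s : R) : (-1 < s)%R -> s <> 0%R -> CGamma (RtoC (s + 1)) = s * CGamma s.
Proof.
  intros H1 H2; destruct (euler_quotient_lim s H1 H2) as [L [HL [K1 K2]]].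
  rewrite (CGamma_is_lim s L), (CGamma_is_lim (s + 1) (s * L)), RtoC_mult; auto; lra.
Qed.

Lemma CGamma_rpoch (s : R) n : (-1 < s)%R -> s <> 0%R ->
  CGamma (RtoC (s + INR n)) = rpoch s n * CGamma s.
Proof.
  intros H1 H2; induction n; [simpl; rewrite Rplus_0_r; ring|].
  rewrite S_INR, <- Rplus_assoc, CGamma_S, IHn.
  - simpl; rewrite RtoC_mult, RtoC_plus; ring.
  - pose proof (pos_INR n); lra.
  - destruct n; [simpl; lra | rewrite S_INR; pose proof (pos_INR n); lra].
Qed.

(** * Closed form of the Legendre function *)

Lemma rpoch_neg_INR (m k : nat) : (m < k)%nat -> rpoch (- INR m) k = 0%R.
Proof.
  intros H; induction H; simpl.
  - rewrite Rplus_opp_l; ring.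
  - rewrite IHle; ring.
Qed.

(** Depending on the parity of M, one of (1 - M) / 2 and - M / 2 is an integer - m with 0 <= m < k,
    so a zero factor occurs. *)
Lemma rpoch_half_vanish (M k : nat) : (M < 2 * k)%nat ->
  (rpoch ((1 - INR M) / 2) k * rpoch (- INR M / 2) k = 0)%R.
Proof.
  intros H; destruct (Nat.Even_or_Odd M) as [[m ->]|[m ->]].
  - replace (- INR (2 * m) / 2)%R with (- INR m)%R by (rewrite mult_INR; simpl; field).
    rewrite (rpoch_neg_INR m k) by lia; ring.
  - replace ((1 - INR (2 * m + 1)) / 2)%R with (- INR m)%R
      by (rewrite plus_INR, mult_INR; simpl; field).
    rewrite (rpoch_neg_INR m k) by lia; ring.
Qed.

(** A duplication formula: the two symbols multiply to (- M)_(2k) / 4^k with M = 2 k + i, and each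
    step in k removes two factors of M!. Using i instead of M - 2 k avoids a subtraction in the
    statement. *)
Lemma rpoch_half (k i : nat) :
  (rpoch ((1 - INR (2 * k + i)) / 2) k * rpoch (- INR (2 * k + i) / 2) k * 4 ^ k * INR (fact i)
   = INR (fact (2 * k + i)))%R.
Proof.
  set (M := (2 * k + i)%nat).
  assert (H : forall j, (2 * j <= M)%nat ->
    (rpoch ((1 - INR M) / 2) j * rpoch (- INR M / 2) j * 4 ^ j * INR (fact (M - 2 * j))
     = INR (fact M))%R).
  { induction j; intros Hj.
    - rewrite Nat.sub_0_r; simpl; ring.
    - rewrite <- IHj by lia.
      replace (M - 2 * j)%nat with (S (S (M - 2 * S j))) by lia.
      rewrite !fact_simpl, !mult_INR.
      assert (E : INR (S (M - 2 * S j)) = (INR M - 2 * INR j - 1)%R).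
      { replace (S (M - 2 * S j)) with (M - (2 * j + 1))%nat by lia.
        rewrite minus_INR, plus_INR, mult_INR by lia; simpl; ring. }
      rewrite (S_INR (S (M - 2 * S j))), E; simpl; field. }
  specialize (H k); replace (M - 2 * k)%nat with i in H by (unfold M; lia).
  apply H; unfold M; lia.
Qed.

Lemma Cpower_INR (z : C) n : z <> 0 -> Cpower z (RtoC (INR n)) = z ^ n.
Proof.
  intros Hz.
  assert (E1 : Cexp (Cln z) = z).
  { destruct (polar z Hz) as [H1 H2]; unfold Cexp; simpl.
    rewrite exp_ln by (apply Cmod_pos; auto); rewrite <- H1, <- H2.
    apply C_ext; reflexivity. }
  induction n.
  - unfold Cpower; simpl; rewrite Cmult_0_l; apply Cexp_0.
  - rewrite S_INR, RtoC_plus, Cpower_plus, IHn, Cpow_S.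
    unfold Cpower; rewrite Cmult_1_l, E1; ring.
Qed.

Lemma Cmod_inv_lt_1 (z : C) : (1 < Cmod z)%R -> z <> 0 /\ (Cmod (/ z) < 1)%R.
Proof.
  intros H.
  assert (Hz : z <> 0) by (intros ->; rewrite Cmod_0 in H; lra).
  split; auto; rewrite Cmod_inv by auto.
  rewrite <- Rinv_1; apply Rinv_lt_contravar; lra.
Qed.

Lemma Cpower_shift_factor (z e a : C) :
  slit_plane z -> Im e = 0%R -> (Cmod (e * / z) < 1)%R ->
  Cpower (z + e) a = Cpower z a * Cpower (1 + e * / z) a.
Proof.
  intros Hz He Hm; pose proof (slit_neq_0 z Hz) as Hn.
  assert (E : z * (1 + e * / z) = z + e) by (field; auto).
  assert (EI : Im (z + e) = Im z) by (change (Im (z + e)) with (Im z + Im e)%R; lra).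
  unfold Cpower; rewrite <- E, Cln_mult_right, <- Cexp_plus; auto.
  - f_equal; ring.
  - replace (1 + e * / z) with (1 - - (e * / z)) by ring.
    apply Re_one_minus_pos; rewrite Cmod_opp; auto.
  - rewrite E, EI; auto.
  - rewrite E, EI; auto.
Qed.

(** The product convention is not the power of z^2 - 1, but outside the unit disk z can be factored
    out of both z + 1 and z - 1. The remaining factors 1 + 1/z and 1 - 1/z lie in the right half
    plane, so their arguments add up within the principal range and their powers do combine. *)
Lemma zsq_m1_power_outer (z a : C) :
  cut_plane z -> (1 < Cmod z)%R ->
  zsq_m1_power z a = Cpower z (a + a) * Cpower (1 - 1 / z ^ 2) a.
Proof.
  intros Hz Hm; destruct (cut_plane_slit z Hz) as [Hs _].
  destruct (Cmod_inv_lt_1 z Hm) as [Hn Hi].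
  unfold zsq_m1_power.
  replace (z - 1) with (z + - (1)) by ring.
  rewrite !(Cpower_shift_factor z) by
    (auto; first [simpl; ring
      | rewrite Cmod_mult, ?Cmod_opp, Cmod_1, Rmult_1_l; auto]).
  rewrite Cpower_plus.
  assert (E : Cpower (1 - 1 / z ^ 2) a = Cpower (1 + 1 * / z) a * Cpower (1 + - (1) * / z) a).
  { unfold Cpower; rewrite <- Cexp_plus; f_equal.
    replace (1 - 1 / z ^ 2) with ((1 + 1 * / z) * (1 + - (1) * / z)) by (field; auto).
    assert (R1 : (0 < Re (1 + 1 * / z))%R).
    { replace (1 + 1 * / z) with (1 - - (/ z)) by ring.
      apply Re_one_minus_pos; rewrite Cmod_opp; auto. }
    assert (R2 : (0 < Re (1 + - (1) * / z))%R).
    { replace (1 + - (1) * / z) with (1 - / z) by ring; apply Re_one_minus_pos; auto. }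
    pose proof (Carg_right_bounds _ R1); pose proof (Carg_right_bounds _ R2).
    rewrite Cln_mult; [ring | | | lra].
    - intros K; rewrite K in R1; simpl in R1; lra.
    - intros K; rewrite K in R2; simpl in R2; lra. }
  rewrite E; ring.
Qed.

(** z^M times the terminating Gauss series in 1 / z^2, written as a polynomial so that it is
    analytic on the whole cut plane. For 2 k > M the exponent truncates to 0, but the coefficient
    vanishes. *)
Definition legendre_poly (n M : nat) (mu : R) (z : C) : C :=
  Csum (fun k => RtoC (hyp_term ((1 - INR M) / 2) (- INR M / 2) (INR n + mu + 1) k)
                 * z ^ (M - 2 * k)) M.

Definition legendre_const (nu kappa : R) : C :=
  RtoC (sqrt PI) * Cexp (Ci * PI * kappa) * CGamma (RtoC (nu + kappa + 1)) /
  (Cpower 2 (RtoC (nu + 1)) * CGamma (RtoC (nu + 3 / 2))).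

Lemma hyp_term_half_vanish (M k : nat) (c : R) : (M < 2 * k)%nat ->
  hyp_term ((1 - INR M) / 2) (- INR M / 2) c k = 0%R.
Proof. intros H; unfold hyp_term; rewrite rpoch_half_vanish by auto; unfold Rdiv; ring. Qed.

Lemma legendre_poly_factor (n M : nat) (mu : R) (z : C) : z <> 0 ->
  legendre_poly n M mu z =
  z ^ M * Csum (fun k => RtoC (hyp_term ((1 - INR M) / 2) (- INR M / 2) (INR n + mu + 1) k)
                 * (1 / z ^ 2) ^ k) M.
Proof.
  intros Hz; unfold legendre_poly; rewrite <- Csum_scal; apply Csum_ext; intros k Hk.
  destruct (Nat.le_gt_cases (2 * k) M) as [H|H].
  - replace M with (2 * k + (M - 2 * k))%nat at 4 by lia.
    rewrite Cpow_add_r, Cpow_mult_r.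
    replace (1 / z ^ 2) with (/ z ^ 2) by (field; auto).
    assert (z ^ 2 <> 0) by (apply Cpow_nz; auto).
    rewrite Cpow_inv by auto; field; apply Cpow_nz; auto.
  - rewrite hyp_term_half_vanish by auto; ring.
Qed.

(** With c = n + mu + 1, a = (1 - M) / 2 and b = - M / 2, the parameters of Q are c - a, c - b, c,
    and c - a - b is the order kappa > 0, so Euler's transformation applies. The rest is bookkeeping
    of powers of z and of W = 1 - 1 / z^2. *)
Lemma LegendreQ_outer_eq (n p : nat) (mu : R) (z : C) :
  (n <= p)%nat -> (- (1 / 2) < mu)%R -> cut_plane z -> (1 < Cmod z)%R ->
  LegendreQ_outer (RtoC (INR n + mu - 1 / 2)) (RtoC (INR p + mu + 1 / 2)) z =
  legendre_const (INR n + mu - 1 / 2) (INR p + mu + 1 / 2) *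
  zsq_m1_power z (- RtoC ((INR p + mu + 1 / 2) / 2)) * legendre_poly n (p - n) mu z.
Proof.
  intros Hnp Hmu Hz Hm; destruct (Cmod_inv_lt_1 z Hm) as [Hn Hi].
  pose proof (pos_INR n) as Pn; pose proof (pos_INR p) as Pp.
  set (nu := (INR n + mu - 1 / 2)%R); set (ka := (INR p + mu + 1 / 2)%R).
  set (M := (p - n)%nat).
  assert (HM : INR M = (INR p - INR n)%R) by (unfold M; apply minus_INR; auto).
  unfold LegendreQ_outer, legendre_const.
  set (c := (INR n + mu + 1)%R).
  set (a := ((1 - INR M) / 2)%R); set (b := (- INR M / 2)%R).
  replace ((RtoC nu + RtoC ka + 1) / 2) with (RtoC (c - a))
    by (unfold nu, ka, c, a; rewrite HM, <- !RtoC_plus, <- RtoC_div by lra; f_equal; field).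
  replace ((RtoC nu + RtoC ka + 2) / 2) with (RtoC (c - b))
    by (unfold nu, ka, c, b; rewrite HM, <- !RtoC_plus, <- RtoC_div by lra; f_equal; field).
  replace (RtoC nu + 3 / 2) with (RtoC c)
    by (unfold nu, c; rewrite <- RtoC_div, <- !RtoC_plus by lra; f_equal; field).
  replace (nu + 3 / 2)%R with c by (unfold nu, c; field).
  replace (RtoC nu + RtoC ka + 1) with (RtoC (nu + ka + 1)) by (rewrite <- !RtoC_plus; auto).
  replace (RtoC nu + 1) with (RtoC (nu + 1)) by (rewrite <- !RtoC_plus; auto).
  assert (Hs : (c - a - b = ka)%R) by (unfold c, a, b, ka; rewrite HM; field).
  assert (HN : forall k, (M < k)%nat -> hyp_term a b c k = 0%R)
    by (intros k Hk; apply hyp_term_half_vanish; lia).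
  rewrite (euler_transformation a b c (1 / z ^ 2) M); [ | unfold c; lra | rewrite Hs; unfold ka; lra | | exact HN].
  2: { replace (1 / z ^ 2) with (/ z * / z) by (field; auto).
       rewrite Cmod_mult; pose proof (Cmod_ge_0 (/ z)); nra. }
  rewrite Hs, legendre_poly_factor by auto.
  fold M; fold c; fold a; fold b.
  set (P := Csum _ M).
  replace (RtoC ka / 2) with (RtoC (ka / 2)) by (rewrite RtoC_div; auto; lra).
  rewrite !zsq_m1_power_outer by auto.
  assert (G1 : CGamma (RtoC c) <> 0) by (apply CGamma_neq_0; unfold c; lra).
  set (W := 1 - 1 / z ^ 2).
  replace (- RtoC (ka / 2) + - RtoC (ka / 2)) with (- RtoC ka)
    by (replace ka with (ka / 2 + ka / 2)%R at 1 by field; rewrite RtoC_plus; ring).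
  replace (RtoC (ka / 2) + RtoC (ka / 2)) with (RtoC ka)
    by (rewrite <- RtoC_plus; f_equal; field).
  replace (- RtoC ka) with (- RtoC (ka / 2) + - RtoC (ka / 2)) at 1
    by (replace ka with (ka / 2 + ka / 2)%R at 3 by field; rewrite RtoC_plus; ring).
  rewrite (Cpower_plus W).
  assert (EW : Cpower W (RtoC (ka / 2)) = / Cpower W (- RtoC (ka / 2))).
  { pose proof (Cpower_opp W (RtoC (ka / 2))) as K.
    pose proof (Cpower_neq_0 W (- RtoC (ka / 2))).
    transitivity (Cpower W (RtoC (ka / 2)) * Cpower W (- RtoC (ka / 2)) / Cpower W (- RtoC (ka / 2)));
      [field; auto | rewrite K; field; auto]. }
  (* nu + kappa + 1 = 2 kappa - M: one z^kappa cancels against (z^2 - 1)^(kappa/2), the other joins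
     the power of W to form (z^2 - 1)^(-kappa/2), and z^M goes to the polynomial. *)
  replace (RtoC (nu + ka + 1)) with (RtoC ka + RtoC ka + - RtoC (INR M)) at 2
    by (rewrite <- !RtoC_plus, <- RtoC_opp, <- RtoC_plus; f_equal; rewrite HM; unfold nu, ka; field).
  rewrite !(Cpower_plus z).
  assert (EM : Cpower z (- RtoC (INR M)) = / z ^ M).
  { pose proof (Cpower_opp z (RtoC (INR M))) as K; rewrite Cpower_INR in K by auto.
    assert (z ^ M <> 0) by (apply Cpow_nz; auto).
    transitivity (z ^ M * Cpower z (- RtoC (INR M)) / z ^ M); [field; auto | rewrite K; field; auto]. }
  assert (EK : Cpower z (- RtoC ka) = / Cpower z (RtoC ka)).
  { pose proof (Cpower_opp z (RtoC ka)) as K.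
    pose proof (Cpower_neq_0 z (RtoC ka)).
    transitivity (Cpower z (RtoC ka) * Cpower z (- RtoC ka) / Cpower z (RtoC ka));
      [field; auto | rewrite K; field; auto]. }
  rewrite EM, EK, EW.
  pose proof (Cpower_neq_0 W (- RtoC (ka / 2))).
  pose proof (Cpower_neq_0 z (RtoC ka)).
  pose proof (Cpower_neq_0 2 (RtoC (nu + 1))).
  assert (z ^ M <> 0) by (apply Cpow_nz; auto).
  field; repeat split; auto.
Qed.

Lemma LegendreQ_eq (n p : nat) (mu : R) (z : C) :
  (n <= p)%nat -> (- (1 / 2) < mu)%R -> cut_plane z ->
  LegendreQ (RtoC (INR n + mu - 1 / 2)) (RtoC (INR p + mu + 1 / 2)) z =
  legendre_const (INR n + mu - 1 / 2) (INR p + mu + 1 / 2) *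
  zsq_m1_power z (- RtoC ((INR p + mu + 1 / 2) / 2)) * legendre_poly n (p - n) mu z.
Proof.
  intros Hnp Hmu; pose proof (pos_INR p).
  apply LegendreQ_unique with (g := fun z =>
    legendre_const (INR n + mu - 1 / 2) (INR p + mu + 1 / 2) *
    zsq_m1_power z (- RtoC ((INR p + mu + 1 / 2) / 2)) * legendre_poly n (p - n) mu z).
  - intros y Hy; apply abs_analytic_analytic.
    apply (abs_analytic_mult (fun z => legendre_const (INR n + mu - 1 / 2) (INR p + mu + 1 / 2) *
      zsq_m1_power z (- RtoC ((INR p + mu + 1 / 2) / 2)))).
    + apply (abs_analytic_mult (fun _ => legendre_const (INR n + mu - 1 / 2) (INR p + mu + 1 / 2)));
        [apply abs_analytic_const | apply abs_analytic_zsq_m1; auto; lra].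
    + apply (abs_analytic_Csum (fun k z => _ * z ^ (p - n - 2 * k))); intros k.
      apply (abs_analytic_mult (fun _ => _)); [apply abs_analytic_const | apply abs_analytic_pow].
  - intros y Hy Hm; symmetry; apply LegendreQ_outer_eq; auto.
Qed.

(** * Gegenbauer polynomials *)

(** The coefficient of ((1 - x) / 2)^k in C_n^mu, with (2 mu)_n (n + 2 mu)_k merged into (2
    mu)_(n+k). *)
Definition gegen_coef (mu : R) (n k : nat) : R :=
  (rpoch (2 * mu) (n + k) * rpoch (- INR n) k /
   (INR (fact n) * (rpoch (mu + 1 / 2) k * INR (fact k))))%R.

Lemma rpoch_add (a : R) n k : (rpoch a n * rpoch (INR n + a) k = rpoch a (n + k))%R.
Proof.
  induction k; [rewrite Nat.add_0_r; simpl; ring|].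
  rewrite Nat.add_succ_r; simpl; rewrite <- IHk, plus_INR; ring.
Qed.

(** The free upper bound [N] lets polynomials of different degrees be summed over one range. *)
Lemma Gegenbauer_sum (mu : R) (n N : nat) (x : C) :
  (- (1 / 2) < mu)%R -> (n <= N)%nat ->
  Gegenbauer n mu x = Csum (fun k => RtoC (gegen_coef mu n k) * ((1 - x) / 2) ^ k) N.
Proof.
  intros Hmu HN; unfold Gegenbauer.
  replace (- RtoC (INR n)) with (RtoC (- INR n)) by apply RtoC_opp.
  replace (RtoC (INR n) + 2 * RtoC mu) with (RtoC (INR n + 2 * mu))
    by (rewrite <- RtoC_mult, <- RtoC_plus; auto).
  replace (RtoC mu + 1 / 2) with (RtoC (mu + 1 / 2))
    by (rewrite <- RtoC_div, <- RtoC_plus by lra; auto).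
  rewrite hyp2F1_RtoC by lra.
  rewrite (CSeries_unique _ (Csum (fun k => RtoC (hyp_term (- INR n) (INR n + 2 * mu) (mu + 1 / 2) k)
     * ((1 - x) / 2) ^ k) N)).
  2: { apply is_Cseries_finite with N; auto.
       intros k Hk; unfold hyp_term; rewrite rpoch_neg_INR by lia.
       unfold Rdiv; rewrite !Rmult_0_l; ring. }
  rewrite <- RtoC_mult, pochhammer_RtoC, <- RtoC_div, <- Csum_scal by apply INR_fact_neq_0.
  apply Csum_ext; intros k _; rewrite Cmult_assoc, <- RtoC_mult; do 2 f_equal.
  unfold hyp_term, gegen_coef; rewrite <- rpoch_add.
  pose proof (rpoch_pos (mu + 1 / 2) k ltac:(lra)); pose proof (INR_fact_neq_0 n);
  pose proof (INR_fact_neq_0 k); field; repeat split; auto; lra.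
Qed.

Lemma rpoch_neg_pred (n k : nat) :
  (- INR (S n) * rpoch (- INR n) k = rpoch (- INR (S n)) k * (INR k - INR (S n)))%R.
Proof.
  replace (- INR n)%R with (- INR (S n) + 1)%R by (rewrite S_INR; ring).
  rewrite <- rpoch_shift; cbn [rpoch]; ring.
Qed.

(** The three-term recurrence read at y^(k+1), where y = (1 - x) / 2; the left side comes from x = 1
    - 2 y. Once all symbols are expressed through (2 mu)_(n+k+1), (- n - 1)_k and (mu + 1/2)_k, a
    rational identity remains. *)
Lemma gegen_coef_recurrence (mu : R) (n k : nat) : (- (1 / 2) < mu)%R ->
  (2 * (INR (S n) + mu) * (gegen_coef mu (S n) (S k) - 2 * gegen_coef mu (S n) k) =
   INR (S (S n)) * gegen_coef mu (S (S n)) (S k) + (INR (S n) + 2 * mu - 1) * gegen_coef mu n (S k))%R.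
Proof.
  intros Hmu; unfold gegen_coef.
  pose proof (rpoch_pos (mu + 1 / 2) k ltac:(lra)) as Hp.
  pose proof (INR_fact_neq_0 n); pose proof (INR_fact_neq_0 k).
  pose proof (pos_INR n) as Hn; pose proof (pos_INR k) as Hk.
  replace (S (S n) + S k)%nat with (S (S (n + S k))) by lia.
  replace (S n + S k)%nat with (S (n + S k)) by lia.
  replace (S n + k)%nat with (n + S k)%nat by lia.
  set (Q := (n + S k)%nat).
  assert (HQ : INR Q = (INR n + INR k + 1)%R) by (unfold Q; rewrite plus_INR, S_INR; ring).
  set (D := rpoch (- INR (S n)) k).
  assert (E1 : rpoch (- INR (S n)) (S k) = (D * (INR k - INR (S n)))%R) by (cbn [rpoch]; unfold D; ring).
  assert (E2 : rpoch (- INR (S (S n))) (S k) = (- INR (S (S n)) * D)%R).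
  { rewrite rpoch_shift; f_equal; unfold D; f_equal; rewrite (S_INR (S n)); ring. }
  assert (E3 : rpoch (- INR n) (S k) =
     (D * (INR k - INR (S n)) * (INR k + 1 - INR (S n)) / - INR (S n))%R).
  { apply Rmult_eq_reg_l with (- INR (S n))%R.
    - rewrite rpoch_neg_pred, E1, !S_INR; field; lra.
    - rewrite S_INR; lra. }
  rewrite E1, E2, E3.
  change (rpoch (2 * mu) (S (S Q))) with (rpoch (2 * mu) Q * (2 * mu + INR Q) * (2 * mu + INR (S Q)))%R.
  change (rpoch (2 * mu) (S Q)) with (rpoch (2 * mu) Q * (2 * mu + INR Q))%R.
  change (rpoch (mu + 1 / 2) (S k)) with (rpoch (mu + 1 / 2) k * (mu + 1 / 2 + INR k))%R.
  rewrite !fact_simpl, !mult_INR, !S_INR, HQ.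
  field; repeat split; auto; lra.
Qed.

Lemma gegen_coef_recurrence_0 (mu : R) (n : nat) :
  (2 * (INR (S n) + mu) * gegen_coef mu (S n) 0 =
   INR (S (S n)) * gegen_coef mu (S (S n)) 0 + (INR (S n) + 2 * mu - 1) * gegen_coef mu n 0)%R.
Proof.
  unfold gegen_coef; rewrite !Nat.add_0_r.
  change (rpoch (2 * mu) (S (S n))) with (rpoch (2 * mu) n * (2 * mu + INR n) * (2 * mu + INR (S n)))%R.
  change (rpoch (2 * mu) (S n)) with (rpoch (2 * mu) n * (2 * mu + INR n))%R.
  simpl rpoch; rewrite !fact_simpl, !mult_INR, !S_INR; simpl fact; simpl INR.
  pose proof (INR_fact_neq_0 n); pose proof (pos_INR n).
  field; repeat split; auto; lra.
Qed.

Lemma Gegenbauer_recurrence (mu : R) (n : nat) (x : C) : (- (1 / 2) < mu)%R ->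
  RtoC (2 * (INR (S n) + mu)) * x * Gegenbauer (S n) mu x =
  RtoC (INR (S (S n))) * Gegenbauer (S (S n)) mu x +
  RtoC (INR (S n) + 2 * mu - 1) * Gegenbauer n mu x.
Proof.
  intros Hmu.
  rewrite (Gegenbauer_sum mu (S (S n)) (S (S n))) by (auto; lia).
  rewrite (Gegenbauer_sum mu n (S (S n))) by (auto; lia).
  set (y := (1 - x) / 2).
  assert (Hx : x = 1 - 2 * y) by (unfold y; field).
  transitivity (RtoC (2 * (INR (S n) + mu)) * Gegenbauer (S n) mu x
    - RtoC (2 * (INR (S n) + mu)) * (2 * y * Gegenbauer (S n) mu x)); [rewrite Hx at 1; ring|].
  (* The two copies of C_(n+1) get different upper bounds: the one multiplied by y starts one power
     later, so both end at y^(n+2). *)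
  rewrite (Gegenbauer_sum mu (S n) (S (S n)) x) at 1 by (auto; lia).
  rewrite (Gegenbauer_sum mu (S n) (S n) x) by (auto; lia); fold y.
  rewrite !(Csum_shift _ (S n)).
  assert (H0 := gegen_coef_recurrence_0 mu n).
  apply (f_equal RtoC) in H0; rewrite RtoC_plus, !(RtoC_mult _ (gegen_coef _ _ _)) in H0.
  transitivity (RtoC (2 * (INR (S n) + mu)) * RtoC (gegen_coef mu (S n) 0) +
    Csum (fun k => RtoC (2 * (INR (S n) + mu)) * (RtoC (gegen_coef mu (S n) (S k)) - 2 * RtoC (gegen_coef mu (S n) k)) * y ^ S k) (S n)).
  - transitivity (RtoC (2 * (INR (S n) + mu)) * RtoC (gegen_coef mu (S n) 0) +
      (RtoC (2 * (INR (S n) + mu)) * Csum (fun k => RtoC (gegen_coef mu (S n) (S k)) * y ^ S k) (S n) +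
       - (2 * RtoC (2 * (INR (S n) + mu)) * y) * Csum (fun k => RtoC (gegen_coef mu (S n) k) * y ^ k) (S n)));
      [simpl Cpow; ring|].
    rewrite <- !Csum_scal, <- Csum_plus; f_equal; apply Csum_ext; intros k _; rewrite Cpow_S; ring.
  - rewrite H0.
    transitivity (RtoC (INR (S (S n))) * RtoC (gegen_coef mu (S (S n)) 0) +
      RtoC (INR (S n) + 2 * mu - 1) * RtoC (gegen_coef mu n 0) +
      (RtoC (INR (S (S n))) * Csum (fun k => RtoC (gegen_coef mu (S (S n)) (S k)) * y ^ S k) (S n) +
       RtoC (INR (S n) + 2 * mu - 1) * Csum (fun k => RtoC (gegen_coef mu n (S k)) * y ^ S k) (S n)));
      [|simpl Cpow; ring].
    rewrite <- !Csum_scal, <- Csum_plus; f_equal; apply Csum_ext; intros k _.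
    assert (H1 : RtoC (2 * (INR (S n) + mu)) *
        (RtoC (gegen_coef mu (S n) (S k)) - 2 * RtoC (gegen_coef mu (S n) k)) =
      RtoC (INR (S (S n))) * RtoC (gegen_coef mu (S (S n)) (S k)) +
      RtoC (INR (S n) + 2 * mu - 1) * RtoC (gegen_coef mu n (S k))).
    { rewrite <- (RtoC_mult 2 (gegen_coef _ _ _)), <- RtoC_minus, <- !RtoC_mult, <- RtoC_plus.
      f_equal; apply gegen_coef_recurrence; auto. }
    rewrite H1; ring.
Qed.

Lemma Gegenbauer_0 (mu : R) (x : C) : (- (1 / 2) < mu)%R -> Gegenbauer 0 mu x = 1.
Proof.
  intros Hmu; rewrite (Gegenbauer_sum mu 0 0) by auto; rewrite Csum_O.
  unfold gegen_coef; simpl; rewrite Cmult_1_r; f_equal; field.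
Qed.

Lemma Gegenbauer_1 (mu : R) (x : C) : (- (1 / 2) < mu)%R -> Gegenbauer 1 mu x = RtoC (2 * mu) * x.
Proof.
  intros Hmu; rewrite (Gegenbauer_sum mu 1 1), Csum_S, Csum_O by auto.
  set (y := (1 - x) / 2).
  assert (Hx : x = 1 - 2 * y) by (unfold y; field).
  assert (E0 : gegen_coef mu 1 0 = (2 * mu)%R) by (unfold gegen_coef; simpl; field).
  assert (E1 : gegen_coef mu 1 1 = (- (4 * mu))%R) by (unfold gegen_coef; simpl; field; lra).
  rewrite E0, E1, Hx, RtoC_opp, !RtoC_mult; simpl; ring.
Qed.

(* Coefficients of the expansion [(2 x)^j / j! = sum_m (coef j m) C_m^mu(x)], defined by
   the recursion that the three-term recurrence imposes on them. *)
Fixpoint gegen_expansion_coef (mu : R) (j m : nat) : R :=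
  match j with
  | O => match m with O => 1 | S _ => 0 end
  | S j' =>
      ((match m with
        | O => 0
        | S m' => INR m * gegen_expansion_coef mu j' m' / (INR m' + mu)
        end + (INR m + 2 * mu) * gegen_expansion_coef mu j' (S m) / (INR (S m) + mu)) / INR (S j'))%R
  end.

Lemma INR_plus_neq_0 (mu : R) n : (- (1 / 2) < mu)%R -> mu <> 0%R -> (INR n + mu <> 0)%R.
Proof.
  intros H1 H2; destruct n; [simpl; lra|]; rewrite S_INR; pose proof (pos_INR n); lra.
Qed.

Lemma gegen_expansion_coef_gt (mu : R) j : forall m, (j < m)%nat -> gegen_expansion_coef mu j m = 0%R.
Proof.
  induction j; intros m Hm; cbn [gegen_expansion_coef].
  - destruct m; [lia | auto].
  - rewrite IHj by lia; destruct m; [lia|].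
    rewrite IHj by lia; unfold Rdiv; ring.
Qed.

(** The recursion at level j + 1 reads only the neighbours m - 1 and m + 1 at level j, so the parity
    of j - m is preserved. *)
Lemma gegen_expansion_coef_odd (mu : R) j : forall m i, (j = m + (2 * i + 1))%nat -> gegen_expansion_coef mu j m = 0%R.
Proof.
  induction j; intros m i Hj; [lia|]; cbn [gegen_expansion_coef].
  assert (E : gegen_expansion_coef mu j (S m) = 0%R).
  { destruct i; [apply gegen_expansion_coef_gt; lia | apply (IHj _ i); lia]. }
  rewrite E; destruct m; [unfold Rdiv; ring|].
  rewrite (IHj m i) by lia; unfold Rdiv; ring.
Qed.

(** The classical connection coefficient (m + mu) / (k! (mu)_(m+k+1)) for j = m + 2 k, with the
    factor m + mu cancelled. *)
Definition gegen_expansion_closed_form (mu : R) (m k : nat) : R :=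
  (/ (rpoch mu m * rpoch (INR m + mu + 1) k * INR (fact k)))%R.

(** Relative to the claimed value, the two neighbours contribute m (m + mu + k) / (m + mu) and (m +
    2 mu) k / (m + mu); their sum is m + 2 k, the index by which the recursion divides. *)
Lemma gegen_expansion_coef_even (mu : R) : (- (1 / 2) < mu)%R -> mu <> 0%R ->
  forall j m k, (j = m + 2 * k)%nat -> gegen_expansion_coef mu j m = gegen_expansion_closed_form mu m k.
Proof.
  intros H1 H2; induction j; intros m k Hj.
  - replace m with 0%nat by lia; replace k with 0%nat by lia.
    unfold gegen_expansion_closed_form; simpl; field.
  - cbn [gegen_expansion_coef].
    assert (Ppos : forall i a, (0 <= a)%nat -> (rpoch (INR (S a) + mu) i <> 0)%R).
    { intros i a _; apply Rgt_not_eq, rpoch_pos; rewrite S_INR; pose proof (pos_INR a); lra. }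
    assert (Ej : INR (S j) = (INR m + 2 * INR k)%R) by (rewrite Hj, plus_INR, mult_INR; simpl; ring).
    assert (Hj0 : INR (S j) <> 0%R) by (apply not_0_INR; lia).
    pose proof (INR_plus_neq_0 mu m H1 H2) as Nm.
    pose proof (pos_INR m); pose proof (pos_INR k).
    pose proof (rpoch_neq_0 mu m ltac:(lra) H2) as Pm.
    pose proof (Ppos k m ltac:(lia)) as Pk; rewrite S_INR in Pk.
    replace (INR m + 1 + mu)%R with (INR m + mu + 1)%R in Pk by ring.
    pose proof (INR_fact_neq_0 k) as Fk.
    assert (A : (match m with O => 0 | S m' => INR m * gegen_expansion_coef mu j m' / (INR m' + mu) end
       = INR m * ((INR m + mu + INR k) / (INR m + mu)) * gegen_expansion_closed_form mu m k)%R).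
    { destruct m as [|m']; [simpl; ring|].
      rewrite (IHj m' k) by lia; unfold gegen_expansion_closed_form.
      cbn [rpoch] in *; pose proof (pos_INR m').
      pose proof (INR_plus_neq_0 mu m' H1 H2) as Nm'.
      assert (E : ((INR m' + mu + 1) * rpoch (INR (S m') + mu + 1) k =
                  rpoch (INR m' + mu + 1) k * (INR (S m') + mu + INR k))%R).
      { replace (INR (S m') + mu + 1)%R with (INR m' + mu + 1 + 1)%R by (rewrite S_INR; ring).
        rewrite <- rpoch_shift; cbn [rpoch]; rewrite S_INR; ring. }
      assert (Pk' : rpoch (INR m' + mu + 1) k <> 0%R).
      { apply Rgt_not_eq, rpoch_pos; pose proof (pos_INR m'); lra. }
      assert (Pm' : rpoch mu m' <> 0%R) by (apply rpoch_neq_0; lra).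
      assert (N2 : (INR m' + mu + 1 <> 0)%R) by (pose proof (pos_INR m'); lra).
      replace (rpoch (INR (S m') + mu + 1) k) with
        (rpoch (INR m' + mu + 1) k * (INR (S m') + mu + INR k) / (INR m' + mu + 1))%R
        by (rewrite <- E; field; auto).
      rewrite S_INR in *.
      field; repeat split; auto; lra. }
    assert (B : ((INR m + 2 * mu) * gegen_expansion_coef mu j (S m) / (INR (S m) + mu)
       = (INR m + 2 * mu) * (INR k / (INR m + mu)) * gegen_expansion_closed_form mu m k)%R).
    { destruct k as [|k'].
      - rewrite gegen_expansion_coef_gt by lia; unfold Rdiv; simpl; ring.
      - rewrite (IHj (S m) k') by lia; unfold gegen_expansion_closed_form.
        replace (INR m + mu + 1)%R with (INR (S m) + mu)%R in * by (rewrite S_INR; ring).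
        rewrite (rpoch_shift (INR (S m) + mu)) in *.
        change (rpoch mu (S m)) with (rpoch mu m * (mu + INR m))%R.
        rewrite fact_simpl, mult_INR.
        pose proof (INR_fact_neq_0 k').
        assert (INR (S k') <> 0)%R by (apply not_0_INR; lia).
        assert (rpoch (INR (S m) + mu + 1) k' <> 0)%R by (intros E; apply Pk; rewrite E; ring).
        assert (INR (S m) + mu <> 0)%R by (rewrite S_INR; lra).
        field; repeat split; auto; lra. }
    rewrite A, B, Ej; rewrite Ej in Hj0.
    field; auto.
Qed.

(** * Expansion of powers *)

Lemma Gegenbauer_expansion (mu : R) (x : C) j : (- (1 / 2) < mu)%R -> mu <> 0%R ->
  Csum (fun m => RtoC (gegen_expansion_coef mu j m) * Gegenbauer m mu x) j =
  (2 * x) ^ j / RtoC (INR (fact j)).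
Proof.
  intros H1 H2; induction j.
  - rewrite Csum_O, Gegenbauer_0 by auto; simpl; field.
  - assert (Fj : RtoC (INR (fact j)) <> 0) by (intros K; apply (INR_fact_neq_0 j), RtoC_inj; auto).
    assert (Sj : RtoC (INR (S j)) <> 0)
      by (intros K; apply (not_0_INR (S j)); [lia | apply RtoC_inj; auto]).
    set (G := fun m => Gegenbauer m mu x) in *.
    assert (Nm : forall m, RtoC (INR m + mu) <> 0)
      by (intros m K; apply (INR_plus_neq_0 mu m H1 H2), RtoC_inj; auto).
    set (A := fun m => match m with O => RtoC 0 | S m' => RtoC (INR m * gegen_expansion_coef mu j m' / (INR m' + mu)) end).
    set (B := fun m => RtoC ((INR m + 2 * mu) * gegen_expansion_coef mu j (S m) / (INR (S m) + mu))).
    assert (E : forall m, RtoC (gegen_expansion_coef mu (S j) m) * G m = / RtoC (INR (S j)) * (A m * G m + B m * G m)).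
    { intros m; cbn [gegen_expansion_coef]; rewrite RtoC_div, RtoC_plus by (apply not_0_INR; lia).
      unfold A, B; destruct m; field; auto. }
    rewrite (Csum_ext _ _ _ (fun m _ => E m)), Csum_scal, Csum_plus.
    (* The terms read from the neighbour m + 1 are moved up by one index, so that everything
       compares term by term with 2 x times the expansion for j; the overhanging top terms vanish
       because their coefficient index exceeds j. *)
    assert (EB : Csum (fun m => B m * G m) (S j) =
       Csum (fun m => match m with O => RtoC 0 | S m' => B m' * G m' end) j).
    { rewrite Csum_S.
      replace (B (S j)) with (RtoC 0)
        by (unfold B; rewrite gegen_expansion_coef_gt by lia; f_equal; unfold Rdiv; ring).
      transitivity (Csum (fun m => B m * G m) j); [ring|].
      destruct j.
      - rewrite !Csum_O; unfold B; rewrite gegen_expansion_coef_gt by lia.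
        replace ((INR 0 + 2 * mu) * 0 / (INR 1 + mu))%R with 0%R by (unfold Rdiv; ring); ring.
      - rewrite Csum_S, (Csum_shift (fun m => match m with O => RtoC 0 | S m' => B m' * G m' end)).
        unfold B at 2; rewrite gegen_expansion_coef_gt by lia.
        replace ((INR (S j) + 2 * mu) * 0 / (INR (S (S j)) + mu))%R with 0%R by (unfold Rdiv; ring); ring. }
    rewrite EB, (Csum_shift (fun m => A m * G m)).
    replace (A 0%nat) with (RtoC 0) by reflexivity.
    assert (E2 : Csum (fun k => A (S k) * G (S k)) j +
       Csum (fun m => match m with O => RtoC 0 | S m' => B m' * G m' end) j =
       2 * x * Csum (fun m => RtoC (gegen_expansion_coef mu j m) * G m) j).
    { rewrite <- Csum_plus, <- Csum_scal; apply Csum_ext; intros m _.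
      unfold A, B; rewrite !RtoC_div by (apply INR_plus_neq_0; auto).
      destruct m.
      (* The three-term recurrence starts at C_1, so m = 0 uses C_1 = 2 mu x instead, with a
         division by mu. *)
      - unfold G; rewrite Gegenbauer_0, Gegenbauer_1 by auto.
        assert (Hmu : RtoC mu <> 0) by (intros K; apply H2, RtoC_inj; auto).
        simpl; rewrite !RtoC_mult, RtoC_plus; field; try rewrite Cplus_0_l; exact Hmu.
      - rewrite RtoC_div by (apply INR_plus_neq_0; auto).
        pose proof (Gegenbauer_recurrence mu m x H1) as K; fold (G (S m)) (G (S (S m))) (G m) in K.
        pose proof (Nm (S m)) as N1.
        transitivity (RtoC (gegen_expansion_coef mu j (S m)) / RtoC (INR (S m) + mu) *
          (RtoC (INR (S (S m))) * G (S (S m)) + RtoC (INR (S m) + 2 * mu - 1) * G m)).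
        + replace (INR (S m) + 2 * mu - 1)%R with (INR m + 2 * mu)%R by (rewrite S_INR; ring).
          rewrite !RtoC_mult; field; auto.
        + rewrite <- K, RtoC_mult; field; auto. }
    transitivity (/ RtoC (INR (S j)) * (Csum (fun k => A (S k) * G (S k)) j +
       Csum (fun m => match m with O => RtoC 0 | S m' => B m' * G m' end) j)); [ring|].
    rewrite E2; unfold G; rewrite IHj, fact_simpl, mult_INR, RtoC_mult, Cpow_S; field; auto.
Qed.

(** Relative to the terms for n + 1, multiplication by a and by b produces the weights j and n + 1 -
    j, which add up to n + 1. The factorial form matches (2 x)^j / j! in the Gegenbauer
    expansion. *)
Lemma Cbinomial (a b : C) n :
  (a + b) ^ n = RtoC (INR (fact n)) *
  Csum (fun j => a ^ j * b ^ (n - j) / (RtoC (INR (fact j)) * RtoC (INR (fact (n - j))))) n.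
Proof.
  assert (Fk : forall k, RtoC (INR (fact k)) <> 0)
    by (intros k K; apply (INR_fact_neq_0 k), RtoC_inj; auto).
  induction n.
  - rewrite Csum_O; simpl; field.
  - set (T := fun j => a ^ j * b ^ (S n - j) / (RtoC (INR (fact j)) * RtoC (INR (fact (S n - j))))).
    rewrite Cpow_S, IHn.
    set (U := fun j => a ^ j * b ^ (n - j) / (RtoC (INR (fact j)) * RtoC (INR (fact (n - j))))).
    assert (Ea : a * Csum U n = Csum (fun j => RtoC (INR j) * T j) (S n)).
    { rewrite Csum_shift, <- Csum_scal.
      transitivity (Csum (fun k => RtoC (INR (S k)) * T (S k)) n); [|simpl INR; ring].
      apply Csum_ext; intros k Hk; unfold T, U; rewrite Nat.sub_succ, fact_simpl, mult_INR, RtoC_mult, Cpow_S.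
      field; repeat split; auto; intros K; apply (not_0_INR (S k)); [lia | apply RtoC_inj; auto]. }
    assert (Eb : b * Csum U n = Csum (fun j => RtoC (INR (S n - j)) * T j) (S n)).
    { rewrite Csum_S, Nat.sub_diag, <- Csum_scal.
      transitivity (Csum (fun k => RtoC (INR (S n - k)) * T k) n); [|simpl INR; ring].
      apply Csum_ext; intros k Hk; unfold T, U.
      replace (S n - k)%nat with (S (n - k)) by lia.
      rewrite fact_simpl, mult_INR, RtoC_mult, Cpow_S.
      field; repeat split; auto; intros K; apply (not_0_INR (S (n - k))); [lia | apply RtoC_inj; auto]. }
    transitivity (RtoC (INR (fact n)) * (a * Csum U n + b * Csum U n)); [ring|].
    rewrite Ea, Eb, <- Csum_plus, fact_simpl, mult_INR, RtoC_mult.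
    rewrite (Cmult_comm (RtoC (INR (S n)))), <- Cmult_assoc, <- (Csum_scal (RtoC (INR (S n)))).
    f_equal; apply Csum_ext; intros k Hk.
    rewrite minus_INR, RtoC_minus by auto; ring.
Qed.

Lemma Csum_triangle (f : nat -> nat -> C) p :
  Csum (fun j => Csum (fun m => f j m) j) p =
  Csum (fun m => Csum (fun i => f (m + i)%nat m) (p - m)) p.
Proof.
  induction p; [rewrite !Csum_O; simpl; rewrite ?Csum_O; auto|].
  rewrite Csum_S, IHp, Csum_S, (Csum_S _ p), Nat.sub_diag, Csum_O, Nat.add_0_r.
  rewrite Cplus_assoc, <- Csum_plus; f_equal; apply Csum_ext; intros m Hm.
  replace (S p - m)%nat with (S (p - m)) by lia.
  rewrite Csum_S; do 2 f_equal; lia.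
Qed.

(** The bound on the right stays [M], the extra terms being zero, because [legendre_poly] is summed
    over that range. *)
Lemma Csum_even (f : nat -> C) M :
  (forall k, f (2 * k + 1)%nat = 0) -> (forall i, (M < i)%nat -> f i = 0) ->
  Csum f M = Csum (fun k => f (2 * k)%nat) M.
Proof.
  intros Ho Hv.
  assert (E : forall K, Csum f (2 * K + 1) = Csum (fun k => f (2 * k)%nat) K).
  { induction K.
    - pose proof (Ho 0%nat) as H0; simpl in H0.
      rewrite (Csum_O (fun k => f (2 * k)%nat)); change (Csum f 1 = f 0%nat).
      rewrite Csum_S, Csum_O, H0; ring.
    - replace (2 * S K + 1)%nat with (S (S (2 * K + 1))) by lia.
      rewrite !Csum_S, IHK.
      replace (S (S (2 * K + 1))) with (2 * S K + 1)%nat by lia.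
      rewrite Ho; replace (S (2 * K + 1)) with (2 * S K)%nat by lia; ring. }
  rewrite <- E; symmetry; apply Csum_extend; auto; lia.
Qed.

Lemma power_expansion (p : nat) (mu : R) (z x : C) : (- (1 / 2) < mu)%R -> mu <> 0%R ->
  (z - x) ^ p = RtoC (INR (fact p)) *
    Csum (fun n => RtoC ((- / 2) ^ n / (INR (fact (p - n)) * rpoch mu n))
                   * Gegenbauer n mu x * legendre_poly n (p - n) mu z) p.
Proof.
  intros H1 H2.
  replace (z - x) with (- x + z) by ring.
  rewrite Cbinomial; f_equal.
  (* Writing -x = (-1/2) (2 x) brings each power into the form that is expanded in Gegenbauer
     polynomials. *)
  set (f := fun j m => RtoC ((- / 2) ^ j / INR (fact (p - j)) * gegen_expansion_coef mu j m)
                       * z ^ (p - j) * Gegenbauer m mu x).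
  transitivity (Csum (fun j => Csum (fun m => f j m) j) p).
  - apply Csum_ext; intros j Hj.
    transitivity (RtoC ((- / 2) ^ j / INR (fact (p - j))) * z ^ (p - j) *
       Csum (fun m => RtoC (gegen_expansion_coef mu j m) * Gegenbauer m mu x) j).
    + rewrite Gegenbauer_expansion by auto.
      rewrite RtoC_div, RtoC_pow, RtoC_opp, RtoC_inv by (try apply INR_fact_neq_0; lra).
      replace (- x) with (- / 2 * (2 * x)) by field.
      rewrite (Cpow_mult_l (- / 2) (2 * x)); field; split;
        intros K; apply (INR_fact_neq_0 _ (RtoC_inj _ _ K)).
    + rewrite <- Csum_scal; apply Csum_ext; intros m _; unfold f; rewrite RtoC_mult; ring.
  - rewrite Csum_triangle; apply Csum_ext; intros m Hm.
    set (M := (p - m)%nat).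
    (* For i > M the subtraction [M - i] truncates and the summand need not vanish, so it is cut off
       by hand, as [Csum_even] requires. *)
    set (h := fun i => RtoC (match (i ?= M)%nat with Gt => 0 | _ =>
                (- / 2) ^ (m + i) / INR (fact (M - i)) * gegen_expansion_coef mu (m + i) m end)
                       * z ^ (M - i)).
    transitivity (Gegenbauer m mu x * Csum h M).
    + rewrite <- Csum_scal; apply Csum_ext; intros i Hi; unfold f, h.
      replace (p - (m + i))%nat with (M - i)%nat by (unfold M; lia).
      destruct (Nat.compare_spec i M); try lia; ring.
    + rewrite Csum_even.
      * unfold legendre_poly; rewrite (Cmult_comm _ (Gegenbauer m mu x)), <- Cmult_assoc.
        f_equal; rewrite <- Csum_scal; apply Csum_ext; intros k Hk.
        unfold h; rewrite Cmult_assoc, <- RtoC_mult; f_equal; f_equal.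
        (* For 2 k <= M the closed form meets [rpoch_half]: the 4^k there cancels against
           (-1/2)^(2k), and M! / (M - 2 k)! becomes the numerator of the Gauss coefficient. For 2 k
           > M that coefficient vanishes. *)
        destruct (Nat.compare_spec (2 * k) M) as [Hc|Hc|Hc];
          [ | | rewrite hyp_term_half_vanish by auto; ring];
          (rewrite (gegen_expansion_coef_even mu H1 H2 _ m k) by lia; unfold gegen_expansion_closed_form, hyp_term;
           pose proof (rpoch_half k (M - 2 * k)) as R;
           replace (2 * k + (M - 2 * k))%nat with M in R by lia;
           assert (P4 : (0 < 4 ^ k)%R) by (apply pow_lt; lra);
           pose proof (INR_fact_neq_0 (M - 2 * k)) as F1;
           pose proof (INR_fact_neq_0 M) as F2; pose proof (INR_fact_neq_0 k) as F3;
           pose proof (rpoch_neq_0 mu m ltac:(lra) H2) as F4;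
           assert (F5 : rpoch (INR m + mu + 1) k <> 0%R)
             by (apply Rgt_not_eq, rpoch_pos; pose proof (pos_INR m); lra);
           rewrite <- R in F2 |- *; rewrite pow_add, (pow_mult (- / 2) 2 k);
           replace ((- / 2) ^ 2)%R with (/ 4)%R by field; rewrite pow_inv;
           set (u := rpoch ((1 - INR M) / 2) k) in *; set (v := rpoch (- INR M / 2) k) in *;
           assert (u <> 0 /\ v <> 0)%R by (split; intros E; apply F2; rewrite E; ring);
           field; repeat split; try tauto; lra).
      * intros k; unfold h; rewrite (gegen_expansion_coef_odd mu _ m k) by lia.
        destruct (2 * k + 1 ?= M)%nat; rewrite ?Rmult_0_r; ring.
      * intros i Hi; unfold h; rewrite (proj2 (Nat.compare_gt_iff _ _)) by auto; ring.
Qed.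

(** * Phases, Gamma factors and assembly of the identity *)

Lemma Cexp_2PI (p : nat) : Cexp (Ci * PI * (2 * RtoC (INR p))) = 1.
Proof.
  replace (Ci * PI * (2 * RtoC (INR p))) with ((0 + 2 * INR p * PI)%R * Ci)
    by (rewrite Rplus_0_l, !RtoC_mult; ring).
  unfold Cexp; simpl.
  replace (_ * 0 - 0 * 1)%R with 0%R by ring.
  match goal with |- context [cos ?t] => replace t with (0 + 2 * INR p * PI)%R by ring end.
  rewrite cos_period, sin_period, exp_0, cos_0, sin_0; apply C_ext; simpl; ring.
Qed.

Lemma zsq_m1_power_opp (z a : C) : zsq_m1_power z a * zsq_m1_power z (- a) = 1.
Proof.
  unfold zsq_m1_power.
  transitivity ((Cpower (z + 1) a * Cpower (z + 1) (- a)) *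
    (Cpower (z - 1) a * Cpower (z - 1) (- a))); [ring|].
  rewrite !Cpower_opp; ring.
Qed.

(** Gamma(nu + 3/2) = Gamma(mu + n + 1) = (mu)_n (n + mu) Gamma(mu) and 2^(nu + 1) = 2^(mu + 1/2)
    2^n; in this form the constant cancels the factors n + mu, Gamma(mu) and 2^(mu + 1/2) of the
    theorem. *)
Lemma legendre_const_eq (n p : nat) (mu : R) :
  (- (1 / 2) < mu)%R -> mu <> 0%R ->
  legendre_const (INR n + mu - 1 / 2) (INR p + mu + 1 / 2) =
  RtoC (sqrt PI) * Cexp (Ci * PI * RtoC (INR p + mu + 1 / 2)) *
  CGamma (RtoC (INR n + INR p + 2 * mu + 1)) /
  (Cpower 2 (RtoC (mu + 1 / 2)) * 2 ^ n * (RtoC (rpoch mu n * (INR n + mu)) * CGamma mu)).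
Proof.
  intros H1 H2; unfold legendre_const.
  replace (INR n + mu - 1 / 2 + (INR p + mu + 1 / 2) + 1)%R
    with (INR n + INR p + 2 * mu + 1)%R by field.
  replace (INR n + mu - 1 / 2 + 3 / 2)%R with (mu + INR (S n))%R by (rewrite S_INR; field).
  replace (INR n + mu - 1 / 2 + 1)%R with (mu + 1 / 2 + INR n)%R by field.
  rewrite CGamma_rpoch by (auto; lra).
  rewrite (RtoC_plus (mu + 1 / 2) (INR n)), Cpower_plus, Cpower_INR by (intros K; apply (f_equal Re) in K; simpl in K; lra).
  rewrite (RtoC_mult _ (INR n + mu)), (Rplus_comm (INR n) mu), <- RtoC_mult; reflexivity.
Qed.

Theorem lemma4p4 :
  forall (p : nat) (mu : R) (z x : C),
    (- (1 / 2) < mu)%R -> mu <> 0%R -> cut_plane z ->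
    (z - x) ^ p =
    Cpower 2 (mu + 1 / 2) / sqrt PI *
    Cexp (Ci * PI * (INR p - mu - 1 / 2)) *
    CGamma mu * INR (fact p) *
    zsq_m1_power z ((INR p + mu) / 2 + 1 / 4) *
    Csum (fun n : nat =>
      (- (1)) ^ n * (INR n + mu) * Gegenbauer n mu x /
      (INR (fact (p - n)) * CGamma (INR n + INR p + 2 * mu + 1)) *
      LegendreQ (INR n + mu - 1 / 2) (INR p + mu + 1 / 2) z) p.
Proof.
  intros p mu z x H1 H2 Hz.
  rewrite (power_expansion p mu z x H1 H2).
  set (ka := (INR p + mu + 1 / 2)%R).
  replace ((RtoC (INR p) + mu) / 2 + 1 / 4) with (RtoC (ka / 2))
    by (unfold ka; rewrite <- !RtoC_plus, <- !RtoC_div, <- RtoC_plus by lra; f_equal; field).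
  set (E1 := Cexp (Ci * PI * (INR p - mu - 1 / 2))).
  (* The exponents add up to (p - mu - 1/2) + (p + mu + 1/2) = 2 p, an even integer. *)
  assert (HE : E1 * Cexp (Ci * PI * RtoC ka) = 1).
  { unfold E1, ka; rewrite <- Cexp_plus; etransitivity; [| exact (Cexp_2PI p)]; f_equal.
    rewrite !RtoC_plus, RtoC_div by lra; field. }
  pose proof (zsq_m1_power_opp z (RtoC (ka / 2))) as HZ.
  set (Z := zsq_m1_power z (RtoC (ka / 2))) in *.
  set (Z' := zsq_m1_power z (- RtoC (ka / 2))) in *.
  set (E2 := Cexp (Ci * PI * RtoC ka)) in *.
  set (S := Csum _ p) at 2.
  transitivity (RtoC (INR (fact p)) * (Cpower 2 (mu + 1 / 2) / sqrt PI * E1 * CGamma mu * Z * S)); [|ring].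
  f_equal; unfold S; rewrite <- Csum_scal; apply Csum_ext; intros n Hn.
  replace (RtoC (INR n) + RtoC mu - 1 / 2) with (RtoC (INR n + mu - 1 / 2))
    by (rewrite <- RtoC_div, <- RtoC_plus, <- RtoC_minus by lra; auto).
  replace (RtoC (INR p) + RtoC mu + 1 / 2) with (RtoC ka)
    by (unfold ka; rewrite <- RtoC_div, <- !RtoC_plus by lra; auto).
  replace (RtoC (INR n) + RtoC (INR p) + 2 * RtoC mu + 1) with (RtoC (INR n + INR p + 2 * mu + 1))
    by (rewrite <- RtoC_mult, <- !RtoC_plus; auto).
  replace (RtoC mu + 1 / 2) with (RtoC (mu + 1 / 2)) by (rewrite <- RtoC_div, <- RtoC_plus by lra; auto).
  unfold ka at 1; rewrite LegendreQ_eq, legendre_const_eq by auto; fold ka; fold E2 Z'.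
  pose proof (pos_INR n); pose proof (pos_INR p).
  assert (NG : forall s : R, s <> 0%R -> RtoC s <> 0) by (intros s Hs K; apply Hs, RtoC_inj; auto).
  assert (G1 : CGamma mu <> 0) by (apply CGamma_neq_0; auto; lra).
  assert (G2 : CGamma (RtoC (INR n + INR p + 2 * mu + 1)) <> 0) by (apply CGamma_neq_0; lra).
  pose proof (NG _ (INR_fact_neq_0 (p - n))) as F1.
  pose proof (NG _ (rpoch_neq_0 mu n ltac:(lra) H2)) as F2.
  pose proof (NG _ (INR_plus_neq_0 mu n H1 H2)) as F3.
  assert (F4 : RtoC (sqrt PI) <> 0) by (apply NG, Rgt_not_eq, sqrt_lt_R0, PI_RGT_0).
  pose proof (Cpower_neq_0 2 (RtoC (mu + 1 / 2))) as F5.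
  assert (F6 : RtoC 2 ^ n <> 0) by (apply Cpow_nz, NG; lra).
  (* The sign is the (-1)^n of the theorem, and the power of 2 is the 2^n coming out of 2^(nu +
     1). *)
  assert (F7 : RtoC ((- / 2) ^ n) = (- (1)) ^ n / 2 ^ n).
  { rewrite RtoC_pow, RtoC_opp, RtoC_inv by lra.
    replace (- / RtoC 2) with (- (1) * / RtoC 2) by ring.
    rewrite Cpow_mult_l, Cpow_inv; [field; auto | apply NG; lra]. }
  rewrite RtoC_div, F7, !RtoC_mult by (apply Rmult_integral_contrapositive; split;
    [apply INR_fact_neq_0 | apply rpoch_neq_0; auto; lra]).
  replace (RtoC (INR n) + RtoC mu) with (RtoC (INR n + mu)) by apply RtoC_plus.
  transitivity ((E1 * E2) * (Z * Z') * ((- (1)) ^ n / 2 ^ n /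
    (RtoC (INR (fact (p - n))) * RtoC (rpoch mu n)) * Gegenbauer n mu x * legendre_poly n (p - n) mu z)).
  - rewrite HE, HZ; ring.
  - field; repeat split; auto.
Qed.
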